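(* Let $(W,S)$ be a Coxeter system and let $(\mathscr I,J,K)$ be a $W$-graph biideal, with $C=\{c_w\mid w\in\mathscr I\}$ the $W$-graph basis of $\mathscr S(\mathscr I,J,K)=\mathscr S(\mathscr I,J)$ (which coincides with its $W^{\mathrm o}$-graph basis). For $y,w\in\mathscr I$ with $y<w$ let $\mu_{y,w}$ be the constant term of $q_{y,w}$. Define $\mu\colon C\times C\to\mathbb Z$ by $\mu(c_y,c_w)=\mu_{y,w}$ if $y<w$, $\mu(c_y,c_w)=\mu_{w,y}$ if $w<y$, and $\mu(c_y,c_w)=0$ otherwise, and define $\tau$ from $C$ to the power set of $S\sqcup S^{\mathrm o}$ by $$\tau(c_w)=\mathrm D_J(\mathscr I,w)\sqcup \mathrm D_K(\mathscr I^{-1},w^{-1})^{\mathrm o}.$$ Then $\Gamma=(C,\mu,\tau)$ is a $(W\times W^{\mathrm o})$-graph.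
   Context: Coxeter groups and Hecke algebras. $(W,S)$ is a Coxeter system with length function $l$; $\leqslant$ is the Bruhat order, $\leqslant_L$ is the left weak order: $v\leqslant_L w$ iff $l(w)=l(wv^{-1})+l(v)$. An ideal of $(W,\leqslant_L)$ is a nonempty subset $\mathscr I\subseteq W$ such that $v\leqslant_L w\in\mathscr I$ implies $v\in\mathscr I$. For $J\subseteq S$, $W_J=\langle J\rangle$ and $D_J=\{w\in W\mid l(ws)>l(w)\text{ for all }s\in J\}$. $\mathcal A=\mathbb Z[q,q^{-1}]$, $\mathcal A^+=\mathbb Z[q]$, $a\mapsto\overline a$ is the ring automorphism of $\mathcal A$ with $\overline q=q^{-1}$. The Hecke algebra $\mathcal H=\mathcal H(W)$ is the $\mathcal A$-algebra generated by $\{T_s\mid s\in S\}$ with relations $T_s^2=1+(q-q^{-1})T_s$ and the braid relations $T_sT_tT_s\cdots=T_tT_sT_t\cdots$ ($m(s,t)$ factors each side, $m(s,t)$ the order of $st$). It has $\mathcal A$-basis $\{T_w\}_{w\in W}$, the semilinear ring involution $h\mapsto\overline h$ with $\overline{T_s}=T_s^{-1}$, and the $\mathcal A$-linear antiautomorphism $h\mapsto h^\flat$ fixing every $T_s$. $W^{\mathrm o}$ is the group opposite to $W$, $w\mapsto w^{\mathrm o}$ the natural antiisomorphism $W\to W^{\mathrm o}$; $(W\times W^{\mathrm o},S\sqcup S^{\mathrm o})$ is a Coxeter system, and modules for its Hecke algebra are the same as $(\mathcal H,\mathcal H)$-bimodules. $W$-graphs. For a Coxeter system $(W,S)$, a $W$-graph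 is a triple $\Gamma=(V,\mu,\tau)$ with $V$ a set, $\mu\colon V\times V\to\mathbb Z$, and $\tau$ from $V$ to the power set of $S$, such that the free $\mathcal A$-module $M_\Gamma$ with basis $V$ admits an $\mathcal H$-module structure with $T_sv=-q^{-1}v$ if $s\in\tau(v)$ and $T_sv=qv+\sum_{u\in V,\,s\in\tau(u)}\mu(u,v)u$ if $s\notin\tau(v)$. A $(W\times W^{\mathrm o})$-graph is the same notion for the Coxeter system $(W\times W^{\mathrm o},S\sqcup S^{\mathrm o})$. $W$-graph ideals. Let $\mathscr I$ be an ideal of $(W,\leqslant_L)$ and $J\subseteq S$ with $\mathscr I\subseteq D_J$. For $w\in\mathscr I$ put $\mathrm{SD}(w)=\{s\in S\mid sw<w\}$, $\mathrm{SA}(w)=\{s\mid sw>w,\ sw\in\mathscr I\}$, $\mathrm{WD}(w)=\{s\mid sw>w,\ sw\notin D_J\}$, $\mathrm{WA}(w)=\{s\mid sw>w,\ sw\in D_J\setminus\mathscr I\}$, and $\mathrm D_J(\mathscr I,w)=\mathrm{SD}(w)\cup\mathrm{WD}(w)$. The pair $(\mathscr I,J)$ is a $W$-graph ideal if there is an $\mathcal H$-module $\mathscr S=\mathscr S(\mathscr I,J)$ such that: (i) $\mathscr S$ has an $\mathcal A$-basis $\{b_w\mid w\in\mathscr I\}$ (the standard basis) with $T_sb_w=b_{sw}$ if $s\in\mathrm{SA}(w)$; $T_sb_w=b_{sw}+(q-q^{-1})b_w$ if $s\in\mathrm{SD}(w)$; $T_sb_w=-q^{-1}b_w$ if $s\in\mathrm{WD}(w)$;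 $T_sb_w=qb_w-\sum_{y\in\mathscr I,\,y<sw}r^s_{y,w}b_y$ for some $r^s_{y,w}\in q\mathcal A^+$ if $s\in\mathrm{WA}(w)$; and (ii) $\mathscr S$ admits an $\mathcal A$-semilinear involution $\alpha\mapsto\overline\alpha$ with $\overline{b_1}=b_1$ and $\overline{h\alpha}=\overline h\,\overline\alpha$. It is known that $\mathscr S$ (with these data) is determined by $(\mathscr I,J)$ and has a unique $\mathcal A$-basis $C=\{c_w\mid w\in\mathscr I\}$ (the $W$-graph basis) with $\overline{c_w}=c_w$ and $b_w=c_w+q\sum_{y<w}q_{y,w}c_y$ for polynomials $q_{y,w}\in\mathcal A^+$. Right ideals and biideals. $(\mathscr I,K)$ is a $W$-graph right ideal if $(\mathscr I^{-1},K)$ is a $W$-graph ideal, where $\mathscr I^{-1}=\{w^{-1}\mid w\in\mathscr I\}$. Its right $\mathcal H$-module $\mathscr S^{\mathrm o}(\mathscr I,K)$ is $\mathscr S(\mathscr I^{-1},K)$ with right action $\alpha h=h^\flat\alpha$, with standard basis $b^{\mathrm o}_w$ ($w\in\mathscr I$), where $b^{\mathrm o}_w$ is the standard basis element of $\mathscr S(\mathscr I^{-1},K)$ indexed by $w^{-1}$, and with $W^{\mathrm o}$-graph basis $c^{\mathrm o}_w$, the $W$-graph basis element of $\mathscr S(\mathscr I^{-1},K)$ indexed by $w^{-1}$. If $(\mathscr I,J)$ is a $W$-graph ideal and $(\mathscr I,K)$ is a $W$-graph right ideal, identify $\mathscr S^{\mathrm o}(\mathscr I,K)$ with $\mathscr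 S(\mathscr I,J)$ as $\mathcal A$-modules by putting $b^{\mathrm o}_w=b_w$ for all $w\in\mathscr I$. Then $(\mathscr I,J,K)$ is a $W$-graph biideal if under this identification the left and right $\mathcal H$-actions commute, i.e. make this module, then denoted $\mathscr S(\mathscr I,J,K)$, an $(\mathcal H,\mathcal H)$-bimodule. *)

(* Defs.v *)
From HB Require Import structures.
From mathcomp Require Import all_boot all_order all_algebra.
From mathcomp Require Import generic_quotient boolp classical_sets functions cardinality fsbigop.
From Stdlib Require Import Relation_Operators.

Set Implicit Arguments.
Unset Strict Implicit.
Unset Printing Implicit Defensive.

Import Order.TTheory GRing.Theory.

Local Open Scope classical_set_scope.
Local Open Scope ring_scope.
Local Open Scope quotient_scope.

(* The ring Z[q, 1/q], as a subring of the field of fractions of Z[q]. *)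

Notation fracq := {fraction {poly int}}.
Local Notation "x %:F" := (@FracField.tofrac {poly int} x).

Definition laurent_pred : {pred fracq} :=
  fun x => `[< exists (p : {poly int}) (n : nat), x = p%:F / ('X^n)%:F >].

Lemma tofracXn_neq0 n : ('X^n)%:F != 0 :> fracq.
Proof. by rewrite tofrac_eq0 expf_neq0 // polyX_eq0. Qed.

Lemma laurent_subring_closed : subring_closed laurent_pred.
Proof.
split=> [|x y|x y].
- by apply/asboolP; exists 1, 0%N; rewrite expr0 tofrac1 divr1.
- move=> /asboolP[p [n ->]] /asboolP[r [m ->]].
  apply/asboolP; exists (p * 'X^m - r * 'X^n), (n + m)%N.
  rewrite -mulNr addf_div ?tofracXn_neq0 //.
  by rewrite exprD tofracB !tofracM mulNr.
- move=> /asboolP[p [n ->]] /asboolP[r [m ->]].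
  apply/asboolP; exists (p * r), (n + m)%N.
  by rewrite mulf_div exprD !tofracM.
Qed.

HB.instance Definition _ :=
  GRing.isSubringClosed.Build fracq laurent_pred laurent_subring_closed.

Record laurent := Laurent { lval : fracq; _ : lval \in laurent_pred }.
HB.instance Definition _ := [isSub for lval].
HB.instance Definition _ := [Choice of laurent by <:].
HB.instance Definition _ := [SubChoice_isSubComNzRing of laurent by <:].

Lemma lpoly_subproof (p : {poly int}) : p%:F \in laurent_pred.
Proof. by apply/asboolP; exists p, 0%N; rewrite expr0 tofrac1 divr1. Qed.

Definition lpoly (p : {poly int}) : laurent := Laurent (lpoly_subproof p).

Lemma lpoly_is_zmod_morphism : zmod_morphism lpoly.
Proof. by move=> p r; apply: val_inj; rewrite /= raddfB. Qed.
Lemma lpoly_is_monoid_morphism : monoid_morphism lpoly.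
Proof. by split=> [|p r]; apply: val_inj; rewrite /= ?tofrac1 ?tofracM. Qed.
HB.instance Definition _ :=
  GRing.isZmodMorphism.Build {poly int} laurent lpoly lpoly_is_zmod_morphism.
HB.instance Definition _ :=
  GRing.isMonoidMorphism.Build {poly int} laurent lpoly lpoly_is_monoid_morphism.

Definition q : laurent := lpoly 'X.

Lemma qV_subproof : ('X : {poly int})%:F^-1 \in laurent_pred.
Proof. by apply/asboolP; exists 1, 1%N; rewrite expr1 tofrac1 div1r. Qed.

Definition qV : laurent := Laurent qV_subproof.

Lemma mulqV : q * qV = 1.
Proof. by apply: val_inj; rewrite /= divff // tofrac_eq0 polyX_eq0. Qed.

Lemma laurentP (x : laurent) :
  exists pn : {poly int} * nat, lval x = pn.1%:F / ('X^(pn.2))%:F.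
Proof. by case: x => x /= /asboolP[p [n ->]]; exists (p, n). Qed.

Lemma laurentE (x : laurent) (p : {poly int}) (n : nat) :
  lval x = p%:F / ('X^n)%:F -> x = lpoly p * qV ^+ n.
Proof.
move=> xE; apply: val_inj; rewrite /= xE; congr (_ * _).
rewrite tofracXn -exprVn.
by elim: n {xE} => [|n IHn]; rewrite ?expr0 // !exprS /= -IHn.
Qed.

(* The value at 1/q of an integer polynomial. *)
Definition eval_qV (p : {poly int}) : laurent := (map_poly intr p).[qV].

Lemma eval_qVM : {morph eval_qV : p r / p * r}.
Proof. by move=> p r; rewrite /eval_qV rmorphM hornerM. Qed.
Lemma eval_qVB : {morph eval_qV : p r / p - r}.
Proof. by move=> p r; rewrite /eval_qV rmorphB hornerD hornerN. Qed.
Lemma eval_qVXn n : eval_qV 'X^n = qV ^+ n.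
Proof. by rewrite /eval_qV map_polyXn hornerXn. Qed.

(* The automorphism a |-> abar: p(q) / q ^ n is mapped to p(1/q) q ^ n. *)
Definition lbar (x : laurent) : laurent :=
  let pn := sval (cid (laurentP x)) in eval_qV pn.1 * q ^+ pn.2.

Lemma lbarE (x : laurent) (p : {poly int}) (n : nat) :
  lval x = p%:F / ('X^n)%:F -> lbar x = eval_qV p * q ^+ n.
Proof.
rewrite /lbar; case: (cid _) => -[r m] /= -> /eqP.
rewrite eqr_div ?tofracXn_neq0 // -!tofracM tofrac_eq => /eqP rpE.
have := congr1 eval_qV rpE; rewrite !eval_qVM !eval_qVXn.
move=> /(congr1 (fun z => z * (q ^+ m * q ^+ n))).
have qVX k : qV ^+ k * q ^+ k = 1 by rewrite -exprMn mulrC mulqV expr1n.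
rewrite -mulrA [q ^+ m * _]mulrC [qV ^+ n * _]mulrA qVX mul1r => ->.
by rewrite -!mulrA [q ^+ n * _]mulrC [qV ^+ m * _]mulrA qVX mul1r.
Qed.

Lemma lbar_is_zmod_morphism : zmod_morphism lbar.
Proof.
move=> x y; have [[p n] /= xE] := laurentP x; have [[r m] /= yE] := laurentP y.
rewrite (lbarE xE) (lbarE yE) (@lbarE _ (p * 'X^m - r * 'X^n) (n + m)).
  rewrite eval_qVB !eval_qVM !eval_qVXn mulrBl exprD.
  have qVX k : qV ^+ k * q ^+ k = 1 by rewrite -exprMn mulrC mulqV expr1n.
  congr (_ - _); first by rewrite mulrACA qVX mulr1.
  by rewrite [q ^+ n * _]mulrC mulrACA qVX mulr1.
rewrite /= xE yE -mulNr addf_div ?tofracXn_neq0 //.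
by rewrite exprD tofracB !tofracM mulNr.
Qed.

Lemma lbar_is_monoid_morphism : monoid_morphism lbar.
Proof.
split=> [|x y].
  rewrite (@lbarE _ 1 0); last by rewrite expr0 tofrac1 divr1.
  by rewrite expr0 mulr1 /eval_qV rmorph1 hornerC.
have [[p n] /= xE] := laurentP x; have [[r m] /= yE] := laurentP y.
rewrite (lbarE xE) (lbarE yE) (@lbarE _ (p * r) (n + m)).
  by rewrite eval_qVM exprD mulrACA.
by rewrite /= xE yE mulf_div exprD !tofracM.
Qed.

HB.instance Definition _ :=
  GRing.isZmodMorphism.Build laurent laurent lbar lbar_is_zmod_morphism.
HB.instance Definition _ :=
  GRing.isMonoidMorphism.Build laurent laurent lbar lbar_is_monoid_morphism.

Lemma lbar_q : lbar q = qV.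
Proof.
rewrite (@lbarE _ 'X 0); last by rewrite /= expr0 tofrac1 divr1.
by rewrite expr0 mulr1 /eval_qV map_polyX hornerX.
Qed.

Lemma lbar_qV : lbar qV = q.
Proof.
rewrite (@lbarE _ 1 1); last by rewrite /= expr1 tofrac1 div1r.
by rewrite expr1 /eval_qV rmorph1 hornerC mul1r.
Qed.

Definition is_order (W : groupType) (x : W) (m : nat) : Prop :=
  [/\ (0 < m)%N, (x ^+ m = 1)%g
    & forall k, (0 < k < m)%N -> (x ^+ k <> 1)%g].

Section Coxeter.
Variables (W : groupType) (S : Type) (sg : S -> W).

Definition wprod (r : seq S) : W := (\prod_(s <- r) sg s)%g.

(* The congruence on words generated by (s t) ^ m(s, t) = 1, where m(s, t) is
   the order of s t; for s = t it gives s s = 1, so that the monoid with this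
   presentation is the group with this presentation. *)
Inductive cox_equiv : seq S -> seq S -> Prop :=
| CoxRel s t m : is_order (sg s * sg t)%g m ->
    cox_equiv (flatten (nseq m [:: s; t])) [::]
| CoxCat r1 r1' r2 r2' : cox_equiv r1 r1' -> cox_equiv r2 r2' ->
    cox_equiv (r1 ++ r2) (r1' ++ r2')
| CoxRefl r : cox_equiv r r
| CoxSym r1 r2 : cox_equiv r1 r2 -> cox_equiv r2 r1
| CoxTrans r1 r2 r3 : cox_equiv r1 r2 -> cox_equiv r2 r3 -> cox_equiv r1 r3.

(* The set of Coxeter generators is given as an injective family. *)
Definition coxeter_system : Prop :=
  [/\ injective sg,
      forall s, is_order (sg s) 2,
      forall w, exists r, w = wprod r
    & forall r1 r2, wprod r1 = wprod r2 -> cox_equiv r1 r2].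

Definition has_word (w : W) (n : nat) : Prop :=
  exists r, wprod r = w /\ size r = n.

(* The minimum exists as soon as sg generates W as a monoid. *)
Definition len (w : W) : nat :=
  xget 0%N [set n | has_word w n /\ forall k, has_word w k -> (n <= k)%N].

Definition reflection (t : W) : Prop :=
  exists (w : W) (s : S), t = (w * sg s * w^-1)%g.

Definition bruhat_step (y w : W) : Prop :=
  (exists2 t, reflection t & w = (y * t)%g) /\ (len y < len w)%N.

Definition bruhat_le : W -> W -> Prop := clos_refl_trans W bruhat_step.

Definition bruhat_lt (y w : W) : Prop := bruhat_le y w /\ y <> w.

Definition lweak_le (v w : W) : Prop := len w = (len (w * v^-1)%g + len v)%N.

Definition lweak_ideal (I : set W) : Prop :=
  I !=set0 /\ forall v w, lweak_le v w -> I w -> I v.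

(* The set D_J. *)
Definition Dmin (J : set S) : set W :=
  [set w | forall s, J s -> (len w < len (w * sg s)%g)%N].

Definition SD (w : W) : set S := [set s | bruhat_lt (sg s * w)%g w].
Definition SA (I : set W) (w : W) : set S :=
  [set s | bruhat_lt w (sg s * w)%g /\ I (sg s * w)%g].
Definition WD (J : set S) (w : W) : set S :=
  [set s | bruhat_lt w (sg s * w)%g /\ ~ Dmin J (sg s * w)%g].
Definition WA (I : set W) (J : set S) (w : W) : set S :=
  [set s | bruhat_lt w (sg s * w)%g /\ (Dmin J `\` I) (sg s * w)%g].

(* D_J(I, w); it does not depend on I. *)
Definition descents (J : set S) (w : W) : set S := SD w `|` WD J w.

End Coxeter.

Definition invset (W : groupType) (I : set W) : set W :=
  [set w | I (w^-1)%g].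

Definition oppg (W : Type) : Type := W.

Section OppositeGroup.
Variable W : groupType.
HB.instance Definition _ := Choice.on (oppg W).

Let mulo (x y : oppg W) : oppg W := ((y : W) * (x : W))%g.
Let invo (x : oppg W) : oppg W := ((x : W)^-1)%g.
Let oneo : oppg W := (1 : W)%g.

Let muloA : associative mulo.
Proof. by move=> x y z; rewrite /mulo mulgA. Qed.
Let mul1o : left_id oneo mulo.
Proof. by move=> x; rewrite /mulo /oneo mulg1. Qed.
Let mulo1 : right_id oneo mulo.
Proof. by move=> x; rewrite /mulo /oneo mul1g. Qed.
Let mulVo : left_inverse oneo invo mulo.
Proof. by move=> x; rewrite /mulo /invo mulgV. Qed.
Let muloV : right_inverse oneo invo mulo.
Proof. by move=> x; rewrite /mulo /invo mulVg. Qed.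

HB.instance Definition _ :=
  isGroup.Build (oppg W) muloA mul1o mulo1 mulVo muloV.
End OppositeGroup.

Definition prodg (G H : Type) : Type := (G * H)%type.

Section ProductGroup.
Variables G H : groupType.
HB.instance Definition _ := Choice.copy (prodg G H) (G * H)%type.

Let mulp (x y : prodg G H) : prodg G H := ((x.1 * y.1)%g, (x.2 * y.2)%g).
Let invp (x : prodg G H) : prodg G H := ((x.1^-1)%g, (x.2^-1)%g).
Let onep : prodg G H := (1%g, 1%g).

Let mulpA : associative mulp.
Proof. by move=> x y z; rewrite /mulp /= !mulgA. Qed.
Let mul1p : left_id onep mulp.
Proof. by case=> x y; rewrite /mulp /= !mul1g. Qed.
Let mulp1 : right_id onep mulp.
Proof. by case=> x y; rewrite /mulp /= !mulg1. Qed.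
Let mulVp : left_inverse onep invp mulp.
Proof. by case=> x y; rewrite /mulp /= !mulVg. Qed.
Let mulpV : right_inverse onep invp mulp.
Proof. by case=> x y; rewrite /mulp /= !mulgV. Qed.

HB.instance Definition _ :=
  isGroup.Build (prodg G H) mulpA mul1p mulp1 mulVp mulpV.
End ProductGroup.

(* The Coxeter generators S + S^o of W x W^o. *)
Definition sg2 (W : groupType) (S : Type) (sg : S -> W) (u : S + S) :
    prodg W (oppg W) :=
  match u with
  | inl s => (sg s, (1 : oppg W)%g)
  | inr s => (1%g, (sg s : oppg W))
  end.

(* The Hecke algebra is defined by generators and relations: terms in the
   generators and the scalars, modulo the congruence generated by the axioms of
   an algebra over Z[q, 1/q] and the defining relations. *)

Inductive hterm (S : Type) : Type :=
| HGen of S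
| HScal of laurent
| HAdd of hterm S & hterm S
| HMul of hterm S & hterm S.
Arguments HScal {S}.

HB.instance Definition _ (S : Type) := gen_eqMixin (hterm S).
HB.instance Definition _ (S : Type) := gen_choiceMixin (hterm S).

Section Hecke.
Variables (W : groupType) (S : Type) (sg : S -> W).

(* The product s t s ... with n factors. *)
Fixpoint halt (s t : S) (n : nat) : hterm S :=
  if n is n'.+1 then HMul (HGen s) (halt t s n') else HScal 1.

Inductive hequiv : hterm S -> hterm S -> Prop :=
| HRefl x : hequiv x x
| HSym x y : hequiv x y -> hequiv y x
| HTrans x y z : hequiv x y -> hequiv y z -> hequiv x z
| HAddCong x x' y y' : hequiv x x' -> hequiv y y' ->
    hequiv (HAdd x y) (HAdd x' y')
| HMulCong x x' y y' : hequiv x x' -> hequiv y y' ->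
    hequiv (HMul x y) (HMul x' y')
| HAddA x y z : hequiv (HAdd x (HAdd y z)) (HAdd (HAdd x y) z)
| HAddC x y : hequiv (HAdd x y) (HAdd y x)
| HAdd0 x : hequiv (HAdd (HScal 0) x) x
| HAddN x : hequiv (HAdd (HMul (HScal (-1)) x) x) (HScal 0)
| HMulA x y z : hequiv (HMul x (HMul y z)) (HMul (HMul x y) z)
| HMul1 x : hequiv (HMul (HScal 1) x) x
| HMulDl x y z : hequiv (HMul (HAdd x y) z) (HAdd (HMul x z) (HMul y z))
| HMulDr x y z : hequiv (HMul x (HAdd y z)) (HAdd (HMul x y) (HMul x z))
| HScalD a b : hequiv (HScal (a + b)) (HAdd (HScal a) (HScal b))
| HScalM a b : hequiv (HScal (a * b)) (HMul (HScal a) (HScal b))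
| HScalC a x : hequiv (HMul (HScal a) x) (HMul x (HScal a))
| HQuad s : hequiv (HMul (HGen s) (HGen s))
              (HAdd (HScal 1) (HMul (HScal (q - qV)) (HGen s)))
| HBraid s t m : is_order (sg s * sg t)%g m ->
    hequiv (halt s t m) (halt t s m).

Definition hequivb (x y : hterm S) : bool := `[< hequiv x y >].

Lemma hequivb_equiv : equiv_class_of hequivb.
Proof.
split=> [x|x y|y x z].
- by apply/asboolP; exact: HRefl.
- by apply/asboolP/asboolP; exact: HSym.
- move=> /asboolP xy /asboolP yz; apply/asboolP; exact: HTrans xy yz.
Qed.

Canonical hequiv_rel := EquivRelPack hequivb_equiv.

Definition hecke : Type := {eq_quot hequiv_rel}.

HB.instance Definition _ := Choice.on hecke.

Definition hpi (x : hterm S) : hecke := (\pi_{eq_quot hequiv_rel} x)%qT.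
Definition hrep (h : hecke) : hterm S := repr (h : {eq_quot hequiv_rel}).

Lemma hpiK h : hpi (hrep h) = h.
Proof. exact: reprK. Qed.

Lemma hpiP x y : hequiv x y <-> hpi x = hpi y.
Proof.
split=> [xy|]; first by apply/eqP; rewrite eqmodE; apply/asboolP.
by move=> /eqP; rewrite eqmodE => /asboolP.
Qed.

Lemma hrepP x : hequiv (hrep (hpi x)) x.
Proof. by apply/hpiP; rewrite hpiK. Qed.

Let hadd (x y : hecke) : hecke := hpi (HAdd (hrep x) (hrep y)).
Let hmul (x y : hecke) : hecke := hpi (HMul (hrep x) (hrep y)).
Let hopp (x : hecke) : hecke := hpi (HMul (HScal (-1)) (hrep x)).
Let hscal (a : laurent) : hecke := hpi (HScal a).

Let hpiD x y : hpi (HAdd x y) = hadd (hpi x) (hpi y).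
Proof. by apply/hpiP/HAddCong; apply/HSym/hrepP. Qed.
Let hpiM x y : hpi (HMul x y) = hmul (hpi x) (hpi y).
Proof. by apply/hpiP/HMulCong; apply/HSym/hrepP. Qed.
Let hoppE x : hopp x = hmul (hscal (-1)) x.
Proof. by rewrite -[x in RHS]hpiK -hpiM. Qed.

Let haddA : associative hadd.
Proof.
move=> x y z; rewrite -[x]hpiK -[y]hpiK -[z]hpiK -!hpiD.
exact/hpiP/HAddA.
Qed.
Let haddC : commutative hadd.
Proof. by move=> x y; apply/hpiP/HAddC. Qed.
Let hadd0 : left_id (hscal 0) hadd.
Proof. by move=> x; rewrite -[x]hpiK -hpiD; apply/hpiP/HAdd0. Qed.
Let haddN : left_inverse (hscal 0) hopp hadd.
Proof.
by move=> x; rewrite hoppE -[x]hpiK -hpiM -hpiD; apply/hpiP/HAddN.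
Qed.
Let hmulA : associative hmul.
Proof.
move=> x y z; rewrite -[x]hpiK -[y]hpiK -[z]hpiK -!hpiM.
exact/hpiP/HMulA.
Qed.
Let hmul1 : left_id (hscal 1) hmul.
Proof. by move=> x; rewrite -[x]hpiK -hpiM; apply/hpiP/HMul1. Qed.
Let hscalC a x : hmul (hscal a) x = hmul x (hscal a).
Proof. by rewrite -[x]hpiK -!hpiM; apply/hpiP/HScalC. Qed.
Let hmul1r : right_id (hscal 1) hmul.
Proof. by move=> x; rewrite -hscalC hmul1. Qed.
Let hmulDl : left_distributive hmul hadd.
Proof.
move=> x y z; rewrite -[x]hpiK -[y]hpiK -[z]hpiK -(hpiD (hrep x)).
rewrite -(hpiM (HAdd _ _)) -(hpiM (hrep x)) -(hpiM (hrep y)) -(hpiD (HMul _ _)).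
exact/hpiP/HMulDl.
Qed.
Let hmulDr : right_distributive hmul hadd.
Proof.
move=> x y z; rewrite -[x]hpiK -[y]hpiK -[z]hpiK -(hpiD (hrep y)).
rewrite -(hpiM (hrep x)) -(hpiM (hrep x)) -(hpiM (hrep x)) -(hpiD (HMul _ _)).
exact/hpiP/HMulDr.
Qed.

HB.instance Definition _ := GRing.isZmodule.Build hecke
  haddA haddC hadd0 haddN.
HB.instance Definition _ := GRing.Zmodule_isPzRing.Build hecke
  hmulA hmul1 hmul1r hmulDl hmulDr.

Definition hT (s : S) : hecke := hpi (HGen s).

(* The universal property of the presentation: f gives the images of the
   scalars and g those of the generators. *)
Fixpoint heval (B : pzRingType) (f : laurent -> B) (g : S -> B)
    (x : hterm S) : B :=
  match x with
  | HGen s => g s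
  | HScal a => f a
  | HAdd x y => heval f g x + heval f g y
  | HMul x y => heval f g x * heval f g y
  end.

Fixpoint altprod (B : pzRingType) (x y : B) (n : nat) : B :=
  if n is n'.+1 then x * altprod y x n' else 1.

Definition hecke_lift (B : pzRingType) (f : laurent -> B) (g : S -> B)
  (h : hecke) : B := heval f g (hrep h).

Section Lift.
Variables (B : pzRingType) (f : {rmorphism laurent -> B}) (g : S -> B).
Hypothesis fC : forall a x, f a * x = x * f a.
Hypothesis gQ : forall s, g s * g s = 1 + f (q - qV) * g s.
Hypothesis gB : forall s t m, is_order (sg s * sg t)%g m ->
  altprod (g s) (g t) m = altprod (g t) (g s) m.

Lemma heval_alt s t m : heval f g (halt s t m) = altprod (g s) (g t) m.
Proof. by elim: m s t => [|m IHm] s t /=; rewrite ?rmorph1 ?IHm. Qed.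

Lemma heval_sound x y : hequiv x y -> heval f g x = heval f g y.
Proof.
elim=> //=.
- by move=> x' y' z' _ -> _ ->.
- by move=> x1 x2 y1 y2 _ -> _ ->.
- by move=> x1 x2 y1 y2 _ -> _ ->.
- by move=> *; rewrite addrA.
- by move=> *; rewrite addrC.
- by move=> *; rewrite rmorph0 add0r.
- by move=> *; rewrite rmorphN1 rmorph0 mulN1r addNr.
- by move=> *; rewrite mulrA.
- by move=> *; rewrite rmorph1 mul1r.
- by move=> *; rewrite mulrDl.
- by move=> *; rewrite mulrDr.
- by move=> *; rewrite rmorphD.
- by move=> *; rewrite rmorphM.
- by move=> s; rewrite gQ rmorph1.
- by move=> s t m /gB; rewrite !heval_alt.
Qed.

Lemma hecke_lift_pi x : hecke_lift f g (hpi x) = heval f g x.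
Proof. exact/heval_sound/hrepP. Qed.

Lemma hecke_lift_zmod_morphism : zmod_morphism (hecke_lift f g).
Proof.
move=> x y.
have -> : x - y = hpi (HAdd (hrep x) (HMul (HScal (-1)) (hrep y))).
  by rewrite hpiD hpiK.
by rewrite hecke_lift_pi /= rmorphN1 mulN1r.
Qed.

Lemma hecke_lift_monoid_morphism : monoid_morphism (hecke_lift f g).
Proof.
split=> [|x y]; first by rewrite hecke_lift_pi /= rmorph1.
by rewrite hecke_lift_pi.
Qed.
End Lift.

Lemma hecke_oner_neq0 : (1 : hecke) != 0.
Proof.
apply/eqP => /(congr1 (hecke_lift (idfun : laurent -> laurent) (fun _ => q))).
rewrite !(@hecke_lift_pi laurent idfun) /=.
- by move/eqP; rewrite oner_eq0.
- by move=> *; rewrite mulrC.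
- by move=> _; rewrite mulrBl [qV * q]mulrC mulqV addrC subrK.
- by [].
- by move=> *; rewrite mulrC.
- by move=> _; rewrite mulrBl [qV * q]mulrC mulqV addrC subrK.
- by [].
Qed.

HB.instance Definition _ :=
  GRing.PzSemiRing_isNonZero.Build hecke hecke_oner_neq0.

Let hscalA (a b : laurent) (x : hecke) :
  hscal a * (hscal b * x) = hscal (a * b) * x.
Proof.
rewrite mulrA; congr (_ * _).
by rewrite -[LHS]hpiM; apply/hpiP/HSym/HScalM.
Qed.
Let hscal1 : left_id 1 (fun a (x : hecke) => hscal a * x).
Proof. by move=> x; rewrite mul1r. Qed.
Let hscalDr : right_distributive (fun a (x : hecke) => hscal a * x) +%R.
Proof. by move=> a x y; rewrite mulrDr. Qed.
Let hscalDl (x : hecke) : {morph (fun a => hscal a * x) : a b / a + b}.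
Proof.
move=> a b; rewrite -mulrDl; congr (_ * _).
by rewrite -[RHS]hpiD; apply/hpiP/HScalD.
Qed.

HB.instance Definition _ := GRing.Zmodule_isLmodule.Build laurent hecke
  hscalA hscal1 hscalDr hscalDl.

Let hscalAl (a : laurent) (x y : hecke) : a *: (x * y) = (a *: x) * y.
Proof. exact: mulrA. Qed.
HB.instance Definition _ := GRing.Lmodule_isLalgebra.Build laurent hecke hscalAl.

Let hscalAr (a : laurent) (x y : hecke) : a *: (x * y) = x * (a *: y).
Proof.
change (hscal a * (x * y) = x * (hscal a * y)).
by rewrite !mulrA; congr (_ * _); exact: hscalC.
Qed.
HB.instance Definition _ := GRing.Lalgebra_isAlgebra.Build laurent hecke hscalAr.

Lemma hT_quad s : hT s * hT s = 1 + (q - qV) *: hT s.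
Proof.
change (hmul (hT s) (hT s) = hadd (hscal 1) (hmul (hscal (q - qV)) (hT s))).
by rewrite /hT -!hpiM -!hpiD; apply/hpiP/HQuad.
Qed.

Lemma hpi_alt s t m : hpi (halt s t m) = altprod (hT s) (hT t) m.
Proof. by elim: m s t => [|m IHm] s t //=; rewrite -IHm; exact: hpiM. Qed.

Lemma hT_braid s t m : is_order (sg s * sg t)%g m ->
  altprod (hT s) (hT t) m = altprod (hT t) (hT s) m.
Proof. by move=> mst; rewrite -!hpi_alt; apply/hpiP/HBraid. Qed.

Lemma hpi_scal a : hpi (HScal a) = a%:A.
Proof. by symmetry; exact: (mulr1 (hpi (HScal a))). Qed.

Definition hTV (s : S) : hecke := hT s - (q - qV)%:A.

Lemma hT_mulV s : hT s * hTV s = 1.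
Proof. by rewrite mulrBr hT_quad mulr_algr addrK. Qed.
Lemma hTV_mul s : hTV s * hT s = 1.
Proof. by rewrite mulrBl hT_quad mulr_algl addrK. Qed.

Lemma altprodSr (B : pzRingType) (x y : B) n :
  altprod x y n.+1 = altprod x y n * (if odd n then y else x).
Proof.
elim: n x y => [|n IHn] x y; first by rewrite /= mul1r mulr1.
transitivity (x * altprod y x n.+1) => //.
by rewrite IHn mulrA /=; case: (odd n).
Qed.

Lemma altprod_mulV (B : pzRingType) (x y xV yV : B) n :
  x * xV = 1 -> y * yV = 1 ->
  altprod x y n * (if odd n then altprod xV yV n else altprod yV xV n) = 1.
Proof.
move=> xK yK; elim: n => [|n IHn]; first by rewrite mulr1.
rewrite altprodSr; move: IHn => /=; case: (odd n) => /= IHn;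
  by rewrite -mulrA [_ * (_ * altprod _ _ _)]mulrA ?xK ?yK mul1r.
Qed.

Lemma hTV_braid s t m : is_order (sg s * sg t)%g m ->
  altprod (hTV s) (hTV t) m = altprod (hTV t) (hTV s) m.
Proof.
move=> /hT_braid stE.
have mulLV := altprod_mulV m (hTV_mul s) (hTV_mul t).
have mulRV := altprod_mulV m (hTV_mul t) (hTV_mul s).
have mulVL := altprod_mulV m (hT_mulV s) (hT_mulV t).
have mulVR := altprod_mulV m (hT_mulV t) (hT_mulV s).
case: (odd m) mulLV mulRV mulVL mulVR => L R VL VR.
  by rewrite -[LHS]mulr1 -VR mulrA -stE L mul1r.
by rewrite -[LHS]mulr1 -VL mulrA stE L mul1r.
Qed.

Lemma altprod_converse (x y : hecke) n :
  altprod (x : hecke^c) (y : hecke^c) n =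
  if odd n then altprod x y n else altprod y x n.
Proof.
elim: n x y => // n IHn x y.
have -> : altprod (x : hecke^c) (y : hecke^c) n.+1 =
    @GRing.mul hecke (altprod (y : hecke^c) (x : hecke^c) n) x by [].
by rewrite IHn oddS !altprodSr; case: (odd n).
Qed.

(* The semilinear ring involution with T_s |-> T_s^-1. *)
Definition hbar : hecke -> hecke :=
  hecke_lift (fun a => (lbar a)%:A) hTV.

Let lbarA := GRing.in_alg hecke \o lbar.
Let lbarA_comm a x : lbarA a * x = x * lbarA a.
Proof. by rewrite /lbarA /= mulr_algl mulr_algr. Qed.
Let hTV_quad s : hTV s * hTV s = 1 + lbarA (q - qV) * hTV s.
Proof.
rewrite /lbarA /= (rmorphB lbar) /= lbar_q lbar_qV mulr_algl -opprB scaleNr.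
by rewrite {1}/hTV mulrBl hT_mulV mulr_algl.
Qed.

Lemma hbar_is_zmod_morphism : zmod_morphism hbar.
Proof. exact: (hecke_lift_zmod_morphism lbarA_comm hTV_quad hTV_braid). Qed.
Lemma hbar_is_monoid_morphism : monoid_morphism hbar.
Proof. exact: (hecke_lift_monoid_morphism lbarA_comm hTV_quad hTV_braid). Qed.
HB.instance Definition _ :=
  GRing.isZmodMorphism.Build hecke hecke hbar hbar_is_zmod_morphism.
HB.instance Definition _ :=
  GRing.isMonoidMorphism.Build hecke hecke hbar hbar_is_monoid_morphism.

Lemma hbarT s : hbar (hT s) = hTV s.
Proof. exact: (hecke_lift_pi lbarA_comm hTV_quad hTV_braid). Qed.

Lemma hbarZ a h : hbar (a *: h) = lbar a *: hbar h.
Proof.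
rewrite -[a *: h]mulr_algl rmorphM -[RHS]mulr_algl; congr (_ * _).
have <- : hbar (hpi (HScal a)) = (lbar a)%:A.
  exact: (hecke_lift_pi lbarA_comm hTV_quad hTV_braid).
by congr hbar; exact: mulr1.
Qed.

Definition halgC (a : laurent) : hecke^c := (a%:A : hecke).

Lemma halgC_is_zmod_morphism : zmod_morphism halgC.
Proof. by move=> a b; exact: (rmorphB (GRing.in_alg hecke)). Qed.
Lemma halgC_is_monoid_morphism : monoid_morphism halgC.
Proof.
split=> [|a b]; first exact: (rmorph1 (GRing.in_alg hecke)).
by rewrite [a * b]mulrC; exact: (rmorphM (GRing.in_alg hecke)).
Qed.
HB.instance Definition _ :=
  GRing.isZmodMorphism.Build laurent hecke^c halgC halgC_is_zmod_morphism.
HB.instance Definition _ :=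
  GRing.isMonoidMorphism.Build laurent hecke^c halgC halgC_is_monoid_morphism.

(* The linear antiautomorphism fixing every T_s, as a ring morphism to the
   converse ring. *)
Definition hflat : hecke -> hecke := @hecke_lift hecke^c halgC hT.

Let halgC_comm a (x : hecke^c) : halgC a * x = x * halgC a.
Proof.
change (@GRing.mul hecke x a%:A = @GRing.mul hecke a%:A x).
by rewrite mulr_algl mulr_algr.
Qed.
Let hflat_quad s : (hT s : hecke^c) * hT s = 1 + halgC (q - qV) * hT s.
Proof.
change (hT s * hT s = 1 + hT s * (q - qV)%:A :> hecke).
by rewrite hT_quad mulr_algr.
Qed.
Let hflat_braid s t m : is_order (sg s * sg t)%g m ->
  altprod (hT s : hecke^c) (hT t) m = altprod (hT t : hecke^c) (hT s) m.
Proof. by move=> /hT_braid stE; rewrite !altprod_converse stE. Qed.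

Lemma hflatD : {morph hflat : h h' / h + h'}.
Proof.
move=> h h'.
have B x y : hflat (x - y) = hflat x - hflat y.
  exact: (hecke_lift_zmod_morphism halgC_comm hflat_quad hflat_braid).
have F0 : hflat 0 = 0 by have := B 0 0; rewrite !subrr.
by rewrite -[h' in LHS]opprK B -[- h']sub0r B F0 sub0r opprK.
Qed.
Lemma hflat1 : hflat 1 = 1.
Proof.
exact: (hecke_lift_monoid_morphism halgC_comm hflat_quad hflat_braid).1.
Qed.
Lemma hflatM h h' : hflat (h * h') = hflat h' * hflat h.
Proof.
exact: (hecke_lift_monoid_morphism halgC_comm hflat_quad hflat_braid).2.
Qed.
Lemma hflatT s : hflat (hT s) = hT s.
Proof. exact: (hecke_lift_pi halgC_comm hflat_quad hflat_braid). Qed.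
Lemma hflatZ a h : hflat (a *: h) = a *: hflat h.
Proof.
have hflatA : hflat a%:A = a%:A.
  rewrite -hpi_scal.
  rewrite [LHS](hecke_lift_pi halgC_comm hflat_quad hflat_braid) hpi_scal //.
by rewrite -[a *: h]mulr_algl hflatM hflatA mulr_algr.
Qed.

End Hecke.

(* The family b, restricted to D, is a basis of M; its values outside D are
   irrelevant. *)
Definition is_basis (K : choiceType) (M : lmodType laurent) (D : set K)
    (b : K -> M) : Prop :=
  (forall (r : seq K) (a : K -> laurent),
     uniq r -> (forall k, k \in r -> D k) ->
     \sum_(k <- r) a k *: b k = 0 -> forall k, k \in r -> a k = 0) /\
  (forall v : M, exists (r : seq K) (a : K -> laurent),
     (forall k, k \in r -> D k) /\ v = \sum_(k <- r) a k *: b k).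

Definition is_hmodule (W : groupType) (S : Type) (sg : S -> W)
    (M : lmodType laurent) (act : hecke sg -> M -> M) : Prop :=
  [/\ forall h, linear (act h),
      forall v, linear (act^~ v),
      forall v, act 1 v = v
    & forall h h' v, act (h * h') v = act h (act h' v)].

(* The sum over u in V with s in tau(u) is required to be finite. *)
Definition is_wgraph (W : groupType) (S : Type) (sg : S -> W)
    (V : choiceType) (mu : V -> V -> int) (tau : V -> set S) : Prop :=
  exists (M : lmodType laurent) (e : V -> M) (act : hecke sg -> M -> M),
  [/\ is_basis setT e,
      is_hmodule act,
      forall s v, tau v s -> act (hT sg s) (e v) = - qV *: e v
    & forall s v, ~ tau v s ->
        finite_set [set u | tau u s /\ mu u v <> 0] /\
        act (hT sg s) (e v) =
          q *: e v + \sum_(u \in [set u | tau u s]) (mu u v)%:~R *: e u].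

Section WGraphIdeals.
Variables (W : groupType) (S : Type) (sg : S -> W).
Implicit Types (I : set W) (J K : set S) (M : lmodType laurent).

Definition is_bar_involution M (act : hecke sg -> M -> M) (bar : M -> M) :
    Prop :=
  [/\ {morph bar : u v / u + v},
      forall a v, bar (a *: v) = lbar a *: bar v,
      involutive bar
    & forall h v, bar (act h v) = act (hbar h) (bar v)].

(* (I, J) is a W-graph ideal and M, with the action act, the standard basis
   b_w (w in I) and the involution bar, is the module S(I, J). The values of b
   outside I are irrelevant. The sum over y < s w is finite, Bruhat intervals
   [1, w] being finite. *)
Record is_wgraph_ideal_module I J M (act : hecke sg -> M -> M)
    (b : W -> M) (bar : M -> M) : Prop := IsWGraphIdealModule {
  wgi_ideal : lweak_ideal sg I;
  wgi_Dmin : I `<=` Dmin sg J;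
  wgi_hmodule : is_hmodule act;
  wgi_basis : is_basis I b;
  wgi_SA : forall w s, I w -> SA sg I w s ->
    act (hT sg s) (b w) = b (sg s * w)%g;
  wgi_SD : forall w s, I w -> SD sg w s ->
    act (hT sg s) (b w) = b (sg s * w)%g + (q - qV) *: b w;
  wgi_WD : forall w s, I w -> WD sg J w s ->
    act (hT sg s) (b w) = - qV *: b w;
  wgi_WA : forall w s, I w -> WA sg I J w s ->
    exists r : W -> {poly int},
      act (hT sg s) (b w) =
        q *: b w - \sum_(y \in [set y | I y /\ bruhat_lt sg y (sg s * w)%g])
                      (q * lpoly (r y)) *: b y;
  wgi_bar : is_bar_involution act bar;
  wgi_bar1 : bar (b 1%g) = b 1%g }.

(* c_w (w in I) is the W-graph basis, the polynomial q_{y,w} being Q y w. *)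
Definition is_wgraph_basis I M (b : W -> M) (bar : M -> M) (c : W -> M)
    (Q : W -> W -> {poly int}) : Prop :=
  [/\ is_basis I c,
      forall w, I w -> bar (c w) = c w
    & forall w, I w ->
        b w = c w + q *: \sum_(y \in [set y | I y /\ bruhat_lt sg y w])
                            lpoly (Q y w) *: c y].

Definition invfam (T : Type) (f : W -> T) (w : W) : T := f (w^-1)%g.

(* (I, J, K) is a W-graph biideal and M is the module S(I, J, K): the module
   S(I^-1, K) is identified with S(I, J) as an A-module in such a way that its
   standard basis element of index w^-1 is b_w, the left action of H on it
   becoming acto, so that the right action of h is acto (hflat h). *)
Definition is_wgraph_biideal_module I J K M (act acto : hecke sg -> M -> M)
    (b : W -> M) (bar baro : M -> M) : Prop :=
  [/\ is_wgraph_ideal_module I J act b bar,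
      is_wgraph_ideal_module (invset I) K acto (invfam b) baro
    & forall h h' v,
        act h (acto (hflat h') v) = acto (hflat h') (act h v)].

End WGraphIdeals.

(* Main.v *)
From HB Require Import structures.
Require Import Defs.
From mathcomp Require Import all_boot all_order all_algebra finmap ring.
From mathcomp Require Import boolp classical_sets functions cardinality fsbigop.
From Stdlib Require Import Relation_Operators.

Set Implicit Arguments.
Unset Strict Implicit.
Unset Printing Implicit Defensive.

Import Order.TTheory GRing.Theory.

Local Open Scope classical_set_scope.
Local Open Scope ring_scope.

(** The statement is reduced to the one-sided theorem that the basis c of the
    module of a W-graph ideal carries a W-graph ([wgraph_action]), which is
    applied once to the left action and once to the right action.

    For the one-sided theorem, put C_s = T_s - q. This element is invariant
    under the bar involution, and T_s acts as - 1/q on its image. If s is an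
    ascent of w, then C_s c_w is bar-invariant, so its coefficients in the
    bar-invariant basis c are bar-invariant; they are computed modulo q Z[q]
    from c_w = b_w - q sum Q_{y,w} c_y, from the rule for T_s b_w and, by
    induction on the length, from the known C_s c_y with y < w. The descents s
    of y contribute the constant term of Q_{y,w}, the ascents contribute
    nothing, and b_w contributes c_{sw} if sw is in the ideal. A bar-invariant
    polynomial in q is constant, so the congruence is an equality
    ([wg_formula_ascent]). If s is a strong descent of w, the formula for sw
    expresses c_w by elements on which T_s acts as - 1/q; if s is a weak
    descent, T_s b_w = - b_w / q and bar-invariance force Q_{y,w} = 0 for every
    y of which s is an ascent ([wg_formulaP]). Consequently T_s multiplies by q
    the coefficient at every c_w of which s is an ascent, and comparing such
    coefficients in T_s b_y shows that, for w < y, the symmetrised mu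
    contributes to T_s c_w exactly when y = sw ([coef0_ascent_descent]).

    The sums make sense because Bruhat intervals are finite
    ([bruhat_le_finite]), by the strong exchange condition; the latter is
    obtained from the presentation of W by counting modulo 2 how often a
    reflection is met along a word ([odd_count_wprod]).

    The two sides share the basis c because the two bar involutions coincide
    ([biideal_bar]): both actions of T_s agree on b_1 whenever s is in the
    ideal, and the actions commute.

    Finally the two commuting actions define a ring morphism from the Hecke
    algebra of W x W^o to the endomorphisms of the module; its braid relations
    are those of the two factors, together with commutation for the mixed
    pairs of generators, whose product has order 2. *)

(** * Reflections, strong exchange and the Bruhat order *)

Section CoxeterGroups.
Variables (W : groupType) (S : Type) (sg : S -> W).
Hypothesis coxWS : coxeter_system sg.

Local Notation wprod := (wprod sg).
Local Notation len := (len sg).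
Local Notation bruhat_lt := (bruhat_lt sg).
Local Notation bruhat_le := (bruhat_le sg).

Lemma sg_mul_self s : (sg s * sg s = 1)%g.
Proof. by have [_ /(_ s)[_ + _] _ _] := coxWS; rewrite expg2. Qed.

Lemma sgV s : ((sg s)^-1 = sg s)%g.
Proof. by apply/mulg1_eq/sg_mul_self. Qed.

Lemma sg_neq1 s : sg s <> 1%g.
Proof.
have [_ /(_ s)[_ _ +] _ _] := coxWS; move=> /(_ 1%N isT).
by rewrite expg1.
Qed.

Lemma sgK s w : (sg s * (sg s * w) = w)%g.
Proof. by rewrite mulgA sg_mul_self mul1g. Qed.

Lemma wprod_cons s r : wprod (s :: r) = (sg s * wprod r)%g.
Proof. exact: big_cons. Qed.

Lemma wprod_cat r r' : wprod (r ++ r') = (wprod r * wprod r')%g.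
Proof. exact: big_cat. Qed.

Lemma wprod_rev r : wprod (rev r) = ((wprod r)^-1)%g.
Proof.
elim: r => [|s r IHr]; first by rewrite /wprod !big_nil invg1.
rewrite rev_cons -cats1 wprod_cat IHr !wprod_cons {2}/wprod big_nil mulg1.
by rewrite invgM sgV.
Qed.

Lemma len_min w k : has_word sg w k -> (len w <= k)%N.
Proof.
move=> wk; rewrite /len; case: xgetP => [n _ [_ /(_ _ wk)]//|_]; exact: leq0n.
Qed.

Lemma reduced_word w : exists2 r, wprod r = w & size r = len w.
Proof.
suff: has_word sg w (len w) by case=> r [<- rE]; exists r.
rewrite /len; case: xgetP => [n _ []//|no].
have [_ _ /(_ w)[r wE] _] := coxWS.
have ex : exists n, `[< has_word sg w n >].
  by exists (size r); apply/asboolP; exists r.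
exfalso; apply: (no (ex_minn ex)).
case: ex_minnP => m /asboolP mw min; split=> // k wk.
by apply: min; apply/asboolP.
Qed.

Lemma len_wprod r : (len (wprod r) <= size r)%N.
Proof. by apply: len_min; exists r. Qed.

Lemma len1 : len 1%g = 0%N.
Proof.
by apply/eqP; rewrite -leqn0 (_ : 1%g = wprod [::]) ?len_wprod // /wprod big_nil.
Qed.

Lemma lenV w : len (w^-1)%g = len w.
Proof.
suff le u : (len (u^-1)%g <= len u)%N.
  by apply/eqP; rewrite eqn_leq le -{1}[w]invgK le.
have [r <- <-] := reduced_word u.
by rewrite -wprod_rev -size_rev len_wprod.
Qed.

Lemma len_sg s : len (sg s) = 1%N.
Proof.
apply/eqP; rewrite eqn_leq; apply/andP; split.
  by have := len_wprod [:: s]; rewrite wprod_cons /wprod big_nil mulg1.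
have [r rE <-] := reduced_word (sg s).
by case: r rE => //; rewrite /wprod big_nil => /esym/sg_neq1.
Qed.

(** The reflections met along the word s_1 ... s_n: the i-th one is
    s_1 ... s_(i-1) s_i s_(i-1) ... s_1, and multiplying the word by it on the
    left deletes the letter s_i. *)
Fixpoint refl_seq (r : seq S) : seq W :=
  if r is s :: r' then sg s :: [seq (sg s * x * sg s)%g | x <- refl_seq r']
  else [::].

Lemma count_map_conj (s : S) (l : seq W) (t : W) :
  count_mem t [seq (sg s * x * sg s)%g | x <- l] =
  count_mem (sg s * t * sg s)%g l.
Proof.
rewrite count_map; apply: eq_count => x /=; apply/eqP/eqP => [<-|->].
  by rewrite -!mulgA sg_mul_self mulg1 sgK.
by rewrite -!mulgA sg_mul_self mulg1 sgK.
Qed.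

Lemma count_refl_seq_cons s r t :
  count_mem t (refl_seq (s :: r)) =
  ((sg s == t) + count_mem (sg s * t * sg s)%g (refl_seq r))%N.
Proof. by rewrite -count_map_conj. Qed.

Lemma count_refl_seq_cat r1 r2 t :
  count_mem t (refl_seq (r1 ++ r2)) =
  (count_mem t (refl_seq r1) +
   count_mem ((wprod r1)^-1 * t * wprod r1)%g (refl_seq r2))%N.
Proof.
elim: r1 t => [|s r1 IHr] t.
  by rewrite /wprod big_nil invg1 mul1g mulg1.
rewrite cat_cons !count_refl_seq_cons IHr addnA; congr (_ + count_mem _ _)%N.
by rewrite wprod_cons invgM sgV !mulgA.
Qed.

Lemma wprod_flatten_nseq m s t :
  wprod (flatten (nseq m [:: s; t])) = ((sg s * sg t) ^+ m)%g.
Proof.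
elim: m => [|m IHm] /=; first by rewrite /wprod big_nil.
by rewrite !wprod_cons IHm expgS mulgA.
Qed.

(** Along a power of s t each reflection is the previous one multiplied by the
    rotation s t. *)
Lemma refl_seq_rel m s t :
  refl_seq (flatten (nseq m [:: s; t])) =
  [seq ((sg s * sg t) ^+ i * sg s)%g | i <- iota 0 m.*2].
Proof.
elim: m => [|m IHm] //=; rewrite IHm mul1g; congr [:: _, _ & _].
rewrite -map_comp -[2%N]addn0 iotaDl -!map_comp; apply: eq_map => i /=.
rewrite -[(2 + i)%N]/(i.+2) (expgS _ i.+1) expgSr.
by rewrite -!mulgA.
Qed.

(** A relator (s t)^m runs twice through each reflection it meets. *)
Lemma odd_count_rel m s t x : ((sg s * sg t) ^+ m = 1)%g ->
  ~~ odd (count_mem x (refl_seq (flatten (nseq m [:: s; t])))).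
Proof.
move=> st1; rewrite refl_seq_rel -addnn iotaD map_cat count_cat.
rewrite -[X in iota (_ + X)](addn0) add0n iotaDl -map_comp.
rewrite (_ : map (_ \o _) _ =
             [seq ((sg s * sg t) ^+ i * sg s)%g | i <- iota 0 m]).
  by rewrite addnn odd_double.
by apply: eq_map => i /=; rewrite expgnDr st1 mul1g.
Qed.

Lemma odd_count_inv r1 r2 : cox_equiv sg r1 r2 ->
  wprod r1 = wprod r2 /\
  forall x, odd (count_mem x (refl_seq r1)) = odd (count_mem x (refl_seq r2)).
Proof.
elim=> {r1 r2}.
- move=> s t m [_ st1 _]; rewrite wprod_flatten_nseq st1 /wprod big_nil.
  by split=> // x; rewrite (negbTE (odd_count_rel x st1)).
- move=> r1 r1' r2 r2' _ [E1 O1] _ [E2 O2]; split=> [|x].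
    by rewrite !wprod_cat E1 E2.
  by rewrite !count_refl_seq_cat !oddD O1 E1 O2.
- by [].
- by move=> r1 r2 _ [-> O]; split=> // x; rewrite O.
- by move=> r1 r2 r3 _ [-> O1] _ [-> O2]; split=> // x; rewrite O1.
Qed.

(** The parity is the reflection cocycle of W: it is multiplicative up to
    conjugation under concatenation and trivial on the relators, so it depends
    on the value of the word only. *)
Lemma odd_count_wprod r1 r2 x : wprod r1 = wprod r2 ->
  odd (count_mem x (refl_seq r1)) = odd (count_mem x (refl_seq r2)).
Proof.
by have [_ _ _ cox] := coxWS; move=> /cox/odd_count_inv[_ ->].
Qed.

(** The inclusion of subwords is compared in W, as S need not have a decidable
    equality. *)
Lemma refl_seq_deletion r x : x \in refl_seq r ->
  exists r', [/\ subseq (map sg r') (map sg r), (x * wprod r)%g = wprod r'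
    & (size r' < size r)%N].
Proof.
elim: r x => [//|s r IHr] x; rewrite in_cons => /orP[/eqP->|].
  by exists r; rewrite map_cons subseq_cons wprod_cons sgK.
case/mapP => {}x /IHr[r' [sub xE size_r'] ->]; exists (s :: r').
rewrite /= eqxx; split=> //.
by rewrite !wprod_cons -xE -!mulgA sgK.
Qed.

Lemma reflectionV t : reflection sg t -> (t^-1 = t)%g.
Proof. by case=> w [s ->]; rewrite !invgM invgK sgV mulgA. Qed.

(** Along the word w s w^-1 for t the occurrences of t in the two outer parts
    cancel modulo 2, as w w^-1 has the value of the empty word, and s accounts
    for one more. *)
Lemma odd_count_reflection t : reflection sg t ->
  exists2 r, wprod r = t & odd (count_mem t (refl_seq r)).
Proof.
case=> w [s ->]; have [r rE _] := reduced_word w.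
exists (r ++ s :: rev r).
  by rewrite wprod_cat wprod_cons wprod_rev rE mulgA.
have: odd (count_mem (w * sg s * w^-1)%g (refl_seq (r ++ rev r))) = false.
  rewrite (@odd_count_wprod _ [::]) //.
  by rewrite wprod_cat wprod_rev mulgV /wprod big_nil.
rewrite !count_refl_seq_cat count_refl_seq_cons !oddD rE.
set u := ((_^-1 * _ * _)%g).
have -> : u = sg s by rewrite /u -!mulgA mulVg mulg1 mulKg.
by rewrite eqxx sg_mul_self mul1g /= addbN => ->.
Qed.

(** If t is met an odd number of times, it is met along a reduced word, and
    deleting a letter shortens it. Otherwise t is met an odd number of times
    along words for t w, so that t w is longer. *)
Lemma reflection_len t r : reflection sg t ->
  (len (t * wprod r)%g < len (wprod r))%N = odd (count_mem t (refl_seq r)).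
Proof.
move=> tT; have lt w r1 : wprod r1 = w -> odd (count_mem t (refl_seq r1)) ->
    (len (t * w)%g < len w)%N.
  have [r2 <- r2E] := reduced_word w => /odd_count_wprod-> odd2.
  have : t \in refl_seq r2 by rewrite -has_pred1 has_count; case: count odd2.
  case/refl_seq_deletion => r' [_ -> ltr']; rewrite -r2E.
  exact: leq_ltn_trans (len_wprod _) ltr'.
apply/idP/idP => [lt_len|]; last exact: lt.
apply: contraLR lt_len => odd_r; rewrite -leqNgt ltnW //.
have [r0 r0E odd0] := odd_count_reflection tT.
rewrite -[X in (len X < _)%N](mulKg t) (reflectionV tT).
apply: (lt _ (r0 ++ r)); first by rewrite wprod_cat r0E.
by rewrite count_refl_seq_cat r0E mulVg mul1g oddD odd0 (negbTE odd_r).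
Qed.

Lemma strong_exchange t r : reflection sg t ->
  (len (t * wprod r)%g < len (wprod r))%N ->
  exists2 r', subseq (map sg r') (map sg r) & (t * wprod r)%g = wprod r'.
Proof.
move=> /reflection_len->; have := @refl_seq_deletion r t.
rewrite -has_pred1 has_count; case: count => // n /(_ isT)[r' [? ? _] _].
by exists r'.
Qed.

Lemma reflection_len_neq t w : reflection sg t ->
  (len (t * w)%g < len w)%N || (len w < len (t * w)%g)%N.
Proof.
move=> tT; have [r <- _] := reduced_word w.
rewrite reflection_len //; case: (boolP (odd _)) => //= odd_r.
have [r0 r0E odd0] := odd_count_reflection tT.
have := reflection_len (r0 ++ r) tT.
rewrite wprod_cat r0E -{1}(reflectionV tT) mulKg => ->.
by rewrite count_refl_seq_cat r0E mulVg mul1g oddD odd0 (negbTE odd_r).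
Qed.

Lemma bruhat_le_len y w : bruhat_le y w -> y = w \/ (len y < len w)%N.
Proof.
elim=> {y w} [y w [_ lt]|w|u v w _ [->|uv] _ [<-|vw]]; try by [left|right].
by right; apply: ltn_trans vw.
Qed.

Lemma bruhat_lt_len y w : bruhat_lt y w -> (len y < len w)%N.
Proof. by case=> /bruhat_le_len[]. Qed.

Lemma bruhat_lt_asym y w : bruhat_lt y w -> ~ bruhat_lt w y.
Proof. by move=> /bruhat_lt_len yw /bruhat_lt_len; rewrite ltnNge ltnW. Qed.

Lemma bruhat_lt_sgP s w :
  bruhat_lt w (sg s * w)%g <-> (len w < len (sg s * w)%g)%N.
Proof.
split=> [/bruhat_lt_len//|lt]; split; last first.
  by move=> wE; move: lt; rewrite -wE ltnn.
apply: rt_step; split=> //; exists (w^-1 * sg s * w)%g; last first.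
  by rewrite !mulgA mulgV mul1g.
by exists (w^-1)%g, s; rewrite invgK.
Qed.

Lemma bruhat_sg_gtP s w :
  bruhat_lt (sg s * w)%g w <-> (len (sg s * w)%g < len w)%N.
Proof. by rewrite -{2 4}[w](sgK s); exact: bruhat_lt_sgP. Qed.

Lemma bruhat_sg_total s w : bruhat_lt (sg s * w)%g w \/ bruhat_lt w (sg s * w)%g.
Proof.
rewrite bruhat_lt_sgP bruhat_sg_gtP; apply/orP/reflection_len_neq.
by exists 1%g, s; rewrite mul1g invg1 mulg1.
Qed.

Lemma bruhat_subword y w r : bruhat_le y w -> wprod r = w ->
  exists2 r', subseq (map sg r') (map sg r) & y = wprod r'.
Proof.
move=> yw; elim: yw r => {y w} [y w [[t tT wE] lt]|w|u v w _ IHu _ IHw] r rE.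
- pose t' := (w * t * w^-1)%g.
  have t'T : reflection sg t'.
    by case: tT @t' => v [s ->]; exists (w * v)%g, s; rewrite invgM !mulgA.
  have yE : y = (t' * w)%g.
    by rewrite /t' -mulgA mulVg mulg1 wE -mulgA -{1}(reflectionV tT) mulVg mulg1.
  rewrite yE -rE; apply: strong_exchange => //.
  by rewrite rE -yE.
- by exists r; rewrite ?rE.
- have [r1 r1r vE] := IHw r rE; have [r2 r2r1 ->] := IHu r1 (esym vE).
  by exists r2 => //; apply: subseq_trans r1r.
Qed.

(** Bruhat intervals are finite: by strong exchange the elements below w are
    values of subwords of a fixed word for w. *)
Lemma bruhat_le_finite w : finite_set [set y | bruhat_le y w].
Proof.
have [r rE _] := reduced_word w.
pose f (m : (size r).-tuple bool) := (\prod_(x <- mask m (map sg r)) x)%g.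
apply: (@sub_finite_set _ _ (f @` setT)); last exact/finite_image/finite_finset.
move=> y /bruhat_subword/(_ rE)[r' /subseqP[m sz_m mE] ->].
have sz_m' : size m == size r by rewrite sz_m size_map.
by exists (Tuple sz_m') => //; rewrite /f /= -mE big_map.
Qed.

Lemma bruhat_lt_finite w : finite_set [set y | bruhat_lt y w].
Proof. by apply: sub_finite_set (bruhat_le_finite w) => y []. Qed.

Lemma bruhat_leV y w : bruhat_le y w -> bruhat_le (y^-1)%g (w^-1)%g.
Proof.
elim=> {y w} [y w [[t tT ->] lt]|w|u v w _ uv _ vw].
- apply: rt_step; split; last by rewrite !lenV.
  exists (y * t * y^-1)%g; last first.
    by rewrite invgM (reflectionV tT) !mulgA mulVg mul1g.
  by case: tT => v [s ->]; exists (y * v)%g, s; rewrite invgM !mulgA.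
- exact: rt_refl.
- exact: rt_trans uv vw.
Qed.

Lemma bruhat_ltV y w : bruhat_lt (y^-1)%g (w^-1)%g <-> bruhat_lt y w.
Proof.
suff V u v : bruhat_lt u v -> bruhat_lt (u^-1)%g (v^-1)%g.
  by split=> [/V|/V//]; rewrite !invgK.
by case=> /bruhat_leV uv neq; split=> // /invg_inj.
Qed.

Lemma len_left_descent w : w <> 1%g ->
  exists s v, w = (sg s * v)%g /\ len w = (len v).+1.
Proof.
have [r rE sz_r] := reduced_word w.
case: r rE sz_r => [|s r] rE sz_r; first by rewrite -rE /wprod big_nil.
move=> _; exists s, (wprod r); rewrite -wprod_cons; split=> //.
apply/eqP; rewrite eqn_leq; apply/andP; split; last first.
  by rewrite -sz_r /= ltnS len_wprod.
have [r' r'E <-] := reduced_word (wprod r).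
by apply: len_min; exists (s :: r'); rewrite wprod_cons r'E -wprod_cons.
Qed.

Lemma len_mul_sg s w : (len (sg s * w)%g <= (len w).+1)%N.
Proof.
have [r rE <-] := reduced_word w.
by apply: len_min; exists (s :: r); rewrite wprod_cons rE.
Qed.

Lemma lweak_le_sg s w : (len (sg s * w)%g < len w)%N ->
  lweak_le sg (sg s * w)%g w.
Proof.
move=> lt; rewrite /lweak_le invgM mulgA mulgV mul1g sgV len_sg.
by apply/eqP; rewrite eqn_leq lt andbT -{1}[w](sgK s) len_mul_sg.
Qed.

End CoxeterGroups.

(** * Bar-invariant polynomials in q *)

Lemma lpoly_inj : injective lpoly.
Proof. by move=> p r /(congr1 val)/eqP /=; rewrite tofrac_eq => /eqP. Qed.

Lemma lpolyC (z : int) : lpoly z%:P = z%:~R.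
Proof. by rewrite -{1}[z]intz !rmorph_int. Qed.

Lemma lpolyX : lpoly 'X = q.
Proof. by []. Qed.

Lemma lbar_lpoly p : lbar (lpoly p) = eval_qV p.
Proof.
by rewrite (@lbarE _ p 0) ?expr0 ?mulr1 //= tofrac1 divr1.
Qed.

(** The bar involution turns a polynomial of degree d in q into one of degree d
    in 1/q, so an invariant one has degree 0. *)
Lemma lbar_lpoly_const p : lbar (lpoly p) = lpoly p -> p = (p`_0)%:P.
Proof.
rewrite lbar_lpoly => pE; apply/polyP => -[|k]; rewrite coefC //=.
pose n := size p; pose r : {poly int} := \sum_(i < n) p`_i *: 'X^(n - i).
have rE : r = p * 'X^n.
  apply: lpoly_inj; rewrite rmorphM rmorphXn /= lpolyX -pE /r rmorph_sum /=.
  rewrite /eval_qV (@horner_coef_wide _ n) ?size_poly // big_distrl /=.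
  apply: eq_bigr => i _.
  rewrite coef_map /= -mul_polyC rmorphM rmorphXn /= lpolyC lpolyX -mulrA.
  have -> : q ^+ n = q ^+ i * q ^+ (n - i) by rewrite -exprD subnKC // ltnW.
  rewrite [qV ^+ i * _]mulrA.
  by rewrite -exprMn [qV * q]mulrC mulqV expr1n mul1r.
have: (size r <= n.+1)%N.
  apply: leq_trans (size_sum _ _ _) _; apply/bigmax_leqP => i _.
  by apply: leq_trans (size_scale_leq _ _) _; rewrite size_polyXn ltnS leq_subr.
move=> /leq_sizeP/(_ (k.+1 + n)%N).
rewrite rE coefMXn addnK ifF; last by rewrite ltnNge leq_addl.
by apply; rewrite addSn ltnS leq_addl.
Qed.

(** This turns congruences modulo q between invariant coefficients into
    equalities. *)
Lemma lbar_const (z : int) x p :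
  x = z%:~R + q * lpoly p -> lbar x = x -> x = z%:~R.
Proof.
have -> : z%:~R + q * lpoly p = lpoly (z%:P + 'X * p).
  by rewrite rmorphD rmorphM /= lpolyC.
move=> -> /lbar_lpoly_const ->; rewrite lpolyC coefD coefC coefXM /=.
by rewrite addr0.
Qed.

(** (q + 1/q) q p = (q^2 + 1) p has positive degree unless p = 0. *)
Lemma lbar_qqV p : lbar ((q + qV) * (q * lpoly p)) = (q + qV) * (q * lpoly p) ->
  p = 0.
Proof.
rewrite mulrA mulrDl [qV * q]mulrC mulqV.
have -> : (q * q + 1) * lpoly p = lpoly (('X * 'X + 1) * p).
  by rewrite rmorphM rmorphD rmorph1 rmorphM.
move=> /lbar_lpoly_const pE; apply/eqP; apply: contraT => p_neq0.
have := congr1 (size : {poly int} -> nat) pE.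
have size2 : size ('X * 'X + 1 : {poly int}) = 3.
  by rewrite -expr2 -polyC1 size_XnaddC.
rewrite size_mul // -?size_poly_gt0 size2 //= => sE.
have := size_polyC_leq1 ((('X * 'X + 1) * p)`_0).
by rewrite -sE addSn /= !ltnS leqn0 addn_eq0.
Qed.

(** The ideal q Z[q] of Z[q]. *)
Definition qlpoly : set laurent := [set x | exists p, x = q * lpoly p].

Lemma qlpoly0 : qlpoly 0.
Proof. by exists 0; rewrite rmorph0 mulr0. Qed.

Lemma qlpolyD x y : qlpoly x -> qlpoly y -> qlpoly (x + y).
Proof. by move=> [p ->] [r ->]; exists (p + r); rewrite rmorphD mulrDr. Qed.

Lemma qlpolyN x : qlpoly x -> qlpoly (- x).
Proof. by move=> [p ->]; exists (- p); rewrite rmorphN mulrN. Qed.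

(** * Coordinates in a basis *)

Lemma sum_delta (R : pzRingType) (K : eqType) (r : seq K) (F : K -> R) k :
  uniq r -> \sum_(j <- r) F j * (j == k)%:R = if k \in r then F k else 0.
Proof.
move=> r_uniq; case: ifPn => [kr|kNr].
  rewrite (bigD1_seq k) //= eqxx mulr1 big1 ?addr0 // => j /negbTE->.
  by rewrite mulr0.
rewrite big1_seq // => j /andP[_ jr].
by case: eqP kNr => [<-|_ _]; rewrite ?jr // mulr0.
Qed.

Section Coordinates.
Variables (K : choiceType) (M : lmodType laurent) (D : set K) (c : K -> M).
Hypothesis c_basis : is_basis D c.

Definition has_coord (v : M) (f : K -> laurent) : Prop :=
  exists s : seq K, [/\ uniq s, forall k, k \in s -> D k,
    forall k, k \notin s -> f k = 0 & v = \sum_(k <- s) f k *: c k].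

Lemma sum_widen (s s' : seq K) (f : K -> laurent) :
  uniq s -> uniq s' -> {subset s <= s'} -> (forall k, k \notin s -> f k = 0) ->
  \sum_(k <- s) f k *: c k = \sum_(k <- s') f k *: c k.
Proof.
move=> us us' ss' f0; rewrite [RHS](bigID (mem s)) /= [X in _ + X]big1 ?addr0.
  rewrite -[RHS]big_filter; apply/perm_big/uniq_perm; rewrite ?filter_uniq //.
  by move=> k; rewrite mem_filter; case ks: (k \in s); rewrite //= ss'.
by move=> k /f0->; rewrite scale0r.
Qed.

Lemma has_coord_linear a u v f g : has_coord u f -> has_coord v g ->
  has_coord (a *: u + v) (fun k => a * f k + g k).
Proof.
move=> [s [us sD f0 ->]] [t [ut tD g0 ->]].
have s_st : {subset s <= undup (s ++ t)}.
  by move=> k; rewrite mem_undup mem_cat => ->.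
have t_st : {subset t <= undup (s ++ t)}.
  by move=> k; rewrite mem_undup mem_cat orbC => ->.
exists (undup (s ++ t)); split; first exact: undup_uniq.
- by move=> k; rewrite mem_undup mem_cat => /orP[/sD|/tD].
- move=> k; rewrite mem_undup mem_cat negb_or => /andP[/f0-> /g0->].
  by rewrite mulr0 addr0.
- rewrite (sum_widen us (undup_uniq _) s_st) //.
  rewrite (sum_widen ut (undup_uniq _) t_st) //.
  rewrite scaler_sumr -big_split /=; apply: eq_bigr => k _.
  by rewrite scalerDl scalerA.
Qed.

Lemma has_coord0 : has_coord 0 (fun=> 0).
Proof. by exists [::]; rewrite big_nil. Qed.

Lemma has_coord_basis k : D k -> has_coord (c k) (fun j => (k == j)%:R).
Proof.
move=> Dk; exists [:: k]; split=> //.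
- by move=> j; rewrite inE => /eqP->.
- by move=> j; rewrite inE eq_sym => /negbTE->.
- by rewrite big_seq1 eqxx scale1r.
Qed.

Lemma has_coord_ex v : exists f, has_coord v f.
Proof.
have [_ /(_ v)[r [a [rD ->]]]] := c_basis.
elim: r rD => [|k r IHr] rD.
  by exists (fun=> 0); rewrite big_nil; exact: has_coord0.
have [|f fP] := IHr; first by move=> j jr; apply: rD; rewrite inE jr orbT.
exists (fun j => a k * (k == j)%:R + f j); rewrite big_cons.
by apply: has_coord_linear fP; apply/has_coord_basis/rD; rewrite inE eqxx.
Qed.

Lemma has_coord_unique v f g : has_coord v f -> has_coord v g -> f = g.
Proof.
move=> vf vg; have := has_coord_linear (-1) vf vg.
rewrite scaleN1r addNr => -[s [us sD fg0 s0]].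
apply/funext => k; apply/esym/eqP; rewrite -subr_eq0 addrC -mulN1r; apply/eqP.
case: (boolP (k \in s)) => [ks|/fg0//].
have [free _] := c_basis; exact: (free s _ us sD (esym s0)).
Qed.

Definition bcoord (v : M) : K -> laurent := sval (cid (has_coord_ex v)).

Lemma bcoordP v : has_coord v (bcoord v).
Proof. by rewrite /bcoord; case: cid. Qed.

Lemma bcoordE v f : has_coord v f -> bcoord v = f.
Proof. exact/has_coord_unique/bcoordP. Qed.

Lemma bcoord_lin a u v k : bcoord (a *: u + v) k = a * bcoord u k + bcoord v k.
Proof.
by rewrite (bcoordE (has_coord_linear a (bcoordP u) (bcoordP v))).
Qed.

Lemma bcoord0 k : bcoord 0 k = 0.
Proof. by rewrite (bcoordE has_coord0). Qed.

Lemma bcoordD u v k : bcoord (u + v) k = bcoord u k + bcoord v k.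
Proof. by rewrite -[u]scale1r bcoord_lin mul1r scale1r. Qed.

Lemma bcoordZ a v k : bcoord (a *: v) k = a * bcoord v k.
Proof. by rewrite -[a *: v]addr0 bcoord_lin bcoord0 addr0. Qed.

Lemma bcoordN v k : bcoord (- v) k = - bcoord v k.
Proof. by rewrite -scaleN1r bcoordZ mulN1r. Qed.

Lemma bcoord_sum (T : Type) (r : seq T) (P : pred T) (F : T -> M) k :
  bcoord (\sum_(i <- r | P i) F i) k = \sum_(i <- r | P i) bcoord (F i) k.
Proof. exact: (big_morph (bcoord^~ k) (fun u v => bcoordD u v k) (bcoord0 k)). Qed.

Lemma bcoord_basis k j : D k -> bcoord (c k) j = (k == j)%:R.
Proof. by move=> Dk; rewrite (bcoordE (has_coord_basis Dk)). Qed.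

Lemma bcoord_inj u v : bcoord u = bcoord v -> u = v.
Proof.
have [s [us _ u0 uE]] := bcoordP u; have [t [ut _ v0 vE]] := bcoordP v.
move=> uv; rewrite uE vE -uv (@sum_widen s (undup (s ++ t))) ?undup_uniq //.
  rewrite (@sum_widen t (undup (s ++ t))) ?undup_uniq // ?uv //.
  by move=> k; rewrite mem_undup mem_cat orbC => ->.
by move=> k; rewrite mem_undup mem_cat => ->.
Qed.

Lemma bcoord_sum_basis (r : seq K) (f : K -> laurent) k : uniq r ->
  (forall j, j \in r -> D j) ->
  bcoord (\sum_(j <- r) f j *: c j) k = if k \in r then f k else 0.
Proof.
move=> r_uniq rD; rewrite bcoord_sum -sum_delta //.
by apply: eq_big_seq => j /rD Dj; rewrite bcoordZ bcoord_basis.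
Qed.

Lemma bcoord_fsum (A : set K) (f : K -> laurent) k : A `<=` D ->
  finite_set [set j | A j /\ f j <> 0] ->
  bcoord (\sum_(j \in A) f j *: c j) k = if `[< A k >] then f k else 0.
Proof.
move=> AD Afin; set B := [set j | _ /\ _] in Afin.
have inB j : (j \in fset_set B) = (j \in B) by rewrite in_fset_set.
rewrite (fsbigE (fset_set B)) /=.
- have -> : \sum_(j <- fset_set B | j \in A) f j *: c j =
      \sum_(j <- fset_set B) f j *: c j.
    rewrite [LHS]big_seq_cond [RHS]big_seq_cond; apply: eq_bigl => j.
    by rewrite andbT inB; apply: andb_idr; rewrite !inE => -[].
  rewrite bcoord_sum_basis ?fset_uniq //.
    rewrite inB; case: asboolP => [Ak|nAk].
      by case: ifPn => //; rewrite notin_setE => /not_andP[//|/contrapT].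
    by rewrite ifF //; apply/negbTE; rewrite notin_setE => -[].
  by move=> j; rewrite inB inE => -[/AD].
- exact: fset_uniq.
- by move=> j /=; rewrite inB inE => -[].
- move=> j Aj; rewrite inB notin_setE => /not_andP[//|/contrapT->].
  by rewrite scale0r.
Qed.

Lemma bcoord_semilinear (bar : M -> M) v k :
  {morph bar : u v / u + v} -> (forall a v, bar (a *: v) = lbar a *: bar v) ->
  (forall k, D k -> bar (c k) = c k) ->
  bcoord (bar v) k = lbar (bcoord v k).
Proof.
move=> barD barZ barc; have bar0 : bar 0 = 0.
  by have := barZ 0 0; rewrite rmorph0 !scale0r.
have [s [us sD v0 vE]] := bcoordP v; rewrite {1}vE.
rewrite (big_morph bar barD bar0) bcoord_sum.
rewrite (eq_big_seq (fun j => lbar (bcoord v j) * (j == k)%:R)).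
  rewrite (sum_delta (fun j => lbar (bcoord v j))) //.
  by case: ifPn => // /v0->; rewrite rmorph0.
by move=> j /sD Dj; rewrite barZ barc // bcoordZ bcoord_basis.
Qed.

End Coordinates.

(** * The action of T_s - q on a module *)

Section HeckeModules.
Variables (W : groupType) (S : Type) (sg : S -> W) (M : lmodType laurent).
Variables (act : hecke sg -> M -> M).
Hypothesis actM : is_hmodule act.

Lemma actZ h a v : act h (a *: v) = a *: act h v.
Proof.
have [lin _ _ _] := actM.
have act0 : act h 0 = 0.
  have := lin h 1 0 0; rewrite !scale1r addr0.
  by rewrite -{1}[act h 0]addr0 => /addrI.
by rewrite -[a *: v]addr0 lin act0 addr0.
Qed.

Lemma actD h u v : act h (u + v) = act h u + act h v.
Proof. by have [lin _ _ _] := actM; have := lin h 1 u v; rewrite !scale1r. Qed.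

Lemma act0 h : act h 0 = 0.
Proof. by have := actZ h 0 0; rewrite !scale0r. Qed.

Lemma actN h v : act h (- v) = - act h v.
Proof. by rewrite -scaleN1r actZ scaleN1r. Qed.

Lemma act_sum h (T : Type) (r : seq T) (P : pred T) (F : T -> M) :
  act h (\sum_(i <- r | P i) F i) = \sum_(i <- r | P i) act h (F i).
Proof. exact: (big_morph (act h) (actD h) (act0 h)). Qed.

Lemma act_hD h h' v : act (h + h') v = act h v + act h' v.
Proof. by have [_ lin _ _] := actM; have := lin v 1 h h'; rewrite !scale1r. Qed.

Lemma act_h0 v : act 0 v = 0.
Proof.
have := act_hD 0 0 v; rewrite addr0.
by rewrite -{1}[act 0 v]addr0 => /addrI.
Qed.

Lemma act_hZ a h v : act (a *: h) v = a *: act h v.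
Proof.
by have [_ lin _ _] := actM; rewrite -[a *: h]addr0 lin act_h0 addr0.
Qed.

Lemma act_hN h v : act (- h) v = - act h v.
Proof. by rewrite -[- h]scaleN1r act_hZ scaleN1r. Qed.

Lemma act1 v : act 1 v = v.
Proof. by have [_ _ ->] := actM. Qed.

Lemma act_hM h h' v : act (h * h') v = act h (act h' v).
Proof. by have [_ _ _ ->] := actM. Qed.

Lemma act_TT s v :
  act (hT sg s) (act (hT sg s) v) = v + (q - qV) *: act (hT sg s) v.
Proof. by rewrite -act_hM hT_quad act_hD act1 act_hZ. Qed.

Lemma act_TV s v :
  act (hTV sg s) v = act (hT sg s) v - (q - qV) *: v.
Proof. by rewrite /hTV act_hD act_hN act_hZ act1. Qed.

(** The Kazhdan-Lusztig element T_s - q: it is invariant under the bar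
    involution and T_s acts on its image as -1/q. *)
Definition actC s v := act (hT sg s) v - q *: v.

Lemma actC_sum s (T : Type) (r : seq T) (P : pred T) (F : T -> M) :
  actC s (\sum_(i <- r | P i) F i) = \sum_(i <- r | P i) actC s (F i).
Proof. by rewrite /actC act_sum scaler_sumr -sumrB. Qed.

Lemma actCZ s a v : actC s (a *: v) = a *: actC s v.
Proof. by rewrite /actC actZ scalerBr !scalerA mulrC. Qed.

Lemma actCD s u v : actC s (u + v) = actC s u + actC s v.
Proof. by rewrite /actC actD scalerDr opprD addrACA. Qed.

Lemma actCN s v : actC s (- v) = - actC s v.
Proof. by rewrite -scaleN1r actCZ scaleN1r. Qed.

Lemma act_T s v : act (hT sg s) v = q *: v + actC s v.
Proof. by rewrite /actC addrC subrK. Qed.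

Lemma actC_negP s v :
  act (hT sg s) v = - qV *: v <-> actC s v = - (q + qV) *: v.
Proof.
rewrite act_T; split=> [E|->].
  by rewrite opprD scalerDl -E scaleNr addKr.
by rewrite -scalerDl opprD addNKr.
Qed.

Lemma actCC s v : actC s (actC s v) = - (q + qV) *: actC s v.
Proof.
apply/actC_negP; rewrite {1}/actC actD actN actZ act_TT /actC.
rewrite scalerBl -addrA [q *: _ - _ - _]addrAC subrr add0r.
by rewrite scalerBr scalerA mulNr [qV * q]mulrC mulqV scaleN1r opprK scaleNr addrC.
Qed.

Lemma actC_bar (bar : M -> M) s v : is_bar_involution act bar ->
  bar (actC s v) = actC s (bar v).
Proof.
case=> barD barZ _ bar_act.
rewrite /actC barD -scaleNr barZ bar_act rmorphN /= lbar_q hbarT act_TV.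
by rewrite !scaleNr scalerBl opprB -addrA [qV *: _ - _ - _]addrAC subrr add0r.
Qed.

End HeckeModules.

(** * The W-graph of a W-graph ideal *)

Section WGraphOfIdeal.
Variables (W : groupType) (S : Type) (sg : S -> W).
Hypothesis coxWS : coxeter_system sg.
Variables (I : set W) (J : set S) (M : lmodType laurent).
Variables (act : hecke sg -> M -> M) (b : W -> M) (bar : M -> M).
Hypothesis idealIJ : is_wgraph_ideal_module I J act b bar.
Variables (c : W -> M) (Q : W -> W -> {poly int}).
Hypothesis cP : is_wgraph_basis sg I b bar c Q.

Let actM : is_hmodule act := wgi_hmodule idealIJ.
Let c_basis : is_basis I c. Proof. by case: cP. Qed.
Let bar_c w : I w -> bar (c w) = c w. Proof. by case: cP => _ + _; apply. Qed.

Local Notation C := (actC act).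
Local Notation lt := (bruhat_lt sg).
Local Notation D := (descents sg J).
Local Notation coord := (bcoord c_basis).

Lemma ideal_Dmin w : I w -> Dmin sg J w.
Proof. exact: (wgi_Dmin idealIJ). Qed.

Lemma ideal_SD w s : I w -> SD sg w s -> I (sg s * w)%g.
Proof.
move=> Iw /(bruhat_sg_gtP coxWS) ltw; have [_ down] := wgi_ideal idealIJ.
exact: down (lweak_le_sg coxWS ltw) Iw.
Qed.

Lemma ascentP w s : ~ D w s -> lt w (sg s * w)%g /\ Dmin sg J (sg s * w)%g.
Proof.
move=> /not_orP[nSD nWD]; have [//|ltw] := bruhat_sg_total coxWS s w.
by split=> //; apply/not_notP => nDmin; apply: nWD.
Qed.

Lemma SD_ascent w s : I w -> SD sg w s -> ~ D (sg s * w)%g s.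
Proof.
move=> Iw sdw [|[]]; rewrite /SD /= (sgK coxWS); first exact: bruhat_lt_asym sdw.
by move=> _; apply; exact: ideal_Dmin.
Qed.

Lemma descent_up w s : lt w (sg s * w)%g -> D (sg s * w)%g s.
Proof. by left; rewrite /SD /= (sgK coxWS). Qed.

Definition low w : set W := [set y | I y /\ lt y w].

Lemma low_finite w : finite_set (low w).
Proof. by apply: sub_finite_set (bruhat_lt_finite coxWS w) => y []. Qed.

Definition lows w : seq W := fset_set (low w).

Lemma lowsP w y : reflect (low w y) (y \in lows w).
Proof.
by apply: (iffP idP); rewrite in_fset_set ?inE //; exact: low_finite.
Qed.

Lemma lows_uniq w : uniq (lows w).
Proof. exact: fset_uniq. Qed.

Lemma lows_I w y : y \in lows w -> I y.
Proof. by move=> /lowsP[]. Qed.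

Lemma standard_basisE w : I w ->
  b w = c w + \sum_(y <- lows w) (q * lpoly (Q y w)) *: c y.
Proof.
move=> Iw; have [_ _ /(_ w Iw)->] := cP.
rewrite fsbig_finite; last exact: low_finite.
rewrite scaler_sumr; congr (_ + _).
by apply: eq_bigr => y _; rewrite scalerA.
Qed.

Lemma bcoord_standard w k : I w -> coord (b w) k =
  (w == k)%:R + (if k \in lows w then q * lpoly (Q k w) else 0).
Proof.
move=> Iw; rewrite standard_basisE // bcoordD (bcoord_basis c_basis) //.
rewrite (bcoord_sum_basis c_basis) ?lows_uniq //; exact: lows_I.
Qed.

Lemma bcoord_standard_mod w k : I w ->
  exists p, coord (b w) k = (w == k)%:R + q * lpoly p.
Proof.
move=> Iw; rewrite bcoord_standard //; case: ifP => _; first by exists (Q k w).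
by exists 0; rewrite rmorph0 mulr0.
Qed.

Lemma bcoord_standard_int w k : I w -> exists p, coord (b w) k = lpoly p.
Proof.
move=> /(bcoord_standard_mod k)[p ->]; exists ((w == k)%:R%:P + 'X * p).
by rewrite rmorphD rmorphM /= lpolyC mulrz_nat.
Qed.

(** The coefficient of c_k in (T_s - q) c_w when s is an ascent of w. *)
Definition wg_coef s w k : int :=
  if `[< low w k /\ D k s >] then (Q k w)`_0
  else (`[< I (sg s * w)%g >] && (k == sg s * w)%g)%:R.

(** In terms of T_s - q, the eigenvalue - 1/q of T_s becomes - (q + 1/q). *)
Definition wg_formula w : Prop := forall s,
  (D w s -> C s (c w) = - (q + qV) *: c w) /\
  (~ D w s -> forall k, coord (C s (c w)) k = (wg_coef s w k)%:~R).

(** If sw is in the ideal, T_s b_w = b_{sw} reduces to c_{sw}; otherwise the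
    coefficients of (T_s - q) b_w are in q Z[q] by the rule for weak ascents. *)
Lemma actC_standard_mod w s k : I w -> ~ D w s ->
  qlpoly (coord (C s (b w)) k -
          (`[< I (sg s * w)%g >] && (k == sg s * w)%g)%:R).
Proof.
move=> Iw /[dup] nD /ascentP[ltw Dminw]; case: asboolP => [Isw|nIsw] /=.
  rewrite /actC (wgi_SA idealIJ) // bcoordD bcoordN bcoordZ.
  have [p ->] := bcoord_standard_mod k Isw.
  have [r ->] := bcoord_standard_int k Iw.
  rewrite [k == _]eq_sym addrAC addrAC addrC -addrA addKr.
  by exists (p - r); rewrite rmorphB mulrBr addrC.
have [|r actE] := wgi_WA idealIJ (w := w) (s := s) Iw; first by split.
rewrite subr0 /actC actE addrAC subrr add0r bcoordN; apply: qlpolyN.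
rewrite fsbig_finite; last exact: low_finite.
rewrite bcoord_sum big_seq; apply: big_ind; [exact: qlpoly0|exact: qlpolyD|].
move=> y /(lows_I (w := (sg s * w)%g)) Iy; rewrite bcoordZ.
have [p ->] := bcoord_standard_int k Iy.
by exists (r y * p); rewrite rmorphM mulrA.
Qed.

Lemma poly_const_mod (p : {poly int}) : exists r, p = (p`_0)%:P + 'X * r.
Proof.
elim/poly_ind: p => [|p z _]; first by exists 0; rewrite coef0 mulr0 addr0.
by exists p; rewrite coefD coefMX coefC eqxx add0r mulrC addrC.
Qed.

(** If s is a descent of y, then T_s - q multiplies c_y by - (q + 1/q), and 1/q
    cancels the factor q of q Q_{y,w}, leaving minus the constant term of
    Q_{y,w}. Otherwise (T_s - q) c_y has integer coefficients and the factor q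
    remains. *)
Lemma actC_lower_mod w s k y : wg_formula y -> I y ->
  qlpoly (q * lpoly (Q y w) * coord (C s (c y)) k +
          (if `[< D k s >] then ((Q k w)`_0)%:~R else 0) * (k == y)%:R).
Proof.
move=> /(_ s)[desc asc] Iy; have [Dy|nDy] := pselect (D y s).
  rewrite desc // bcoordZ (bcoord_basis c_basis) // [k == y]eq_sym.
  case: eqP => [yk|_]; last by rewrite !mulr0 addr0; exact: qlpoly0.
  rewrite -yk !mulr1 ifT; last exact/asboolP.
  have [r rE] := poly_const_mod (Q y w); exists (- 'X * Q y w - r).
  have {}rE : lpoly (Q y w) = ((Q y w)`_0)%:~R + q * lpoly r.
    by rewrite {1}rE rmorphD rmorphM /= lpolyC.
  rewrite rmorphB rmorphM rmorphN /= lpolyX.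
  transitivity (- (q * q * lpoly (Q y w)) - q * qV * lpoly (Q y w) +
                ((Q y w)`_0)%:~R); first by ring.
  by rewrite mulqV mul1r {2}rE; ring.
rewrite asc //; case: eqP => [yk|_]; last first.
  rewrite mulr0 addr0; exists (Q y w * (wg_coef s y k)%:~R).
  by rewrite rmorphM rmorph_int mulrA.
rewrite ifF; last by apply/asboolP; rewrite yk.
rewrite mul0r addr0; exists (Q y w * (wg_coef s y k)%:~R).
by rewrite rmorphM rmorph_int mulrA.
Qed.

Lemma actC_bar_invariant s w k : I w ->
  lbar (coord (C s (c w)) k) = coord (C s (c w)) k.
Proof.
move=> Iw; have [barD barZ _ _] := wgi_bar idealIJ.
rewrite -(bcoord_semilinear c_basis _ _ barD barZ) //.
by rewrite (actC_bar actM _ _ (wgi_bar idealIJ)) bar_c.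
Qed.

(** Both sides are bar-invariant and they agree modulo q Z[q]. *)
Lemma wg_formula_ascent w s k : I w -> (forall y, low w y -> wg_formula y) ->
  ~ D w s -> coord (C s (c w)) k = (wg_coef s w k)%:~R.
Proof.
move=> Iw IH nDw; have bar_X := actC_bar_invariant s k Iw.
suff [p XE] : qlpoly (coord (C s (c w)) k - (wg_coef s w k)%:~R).
  by apply: (lbar_const (p := p)) bar_X; rewrite -XE addrC subrK.
have cE : c w = b w - \sum_(y <- lows w) (q * lpoly (Q y w)) *: c y.
  by rewrite standard_basisE // addrK.
pose F y := coord (C s (c y)) k.
pose G y : laurent := if `[< D k s >] then ((Q y w)`_0)%:~R else 0.
have low_sum : qlpoly (\sum_(y <- lows w) (q * lpoly (Q y w) * F y) +
                       if k \in lows w then G k else 0).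
  rewrite -(sum_delta G) ?lows_uniq // -big_split /= big_seq.
  apply: big_ind; [exact: qlpoly0|exact: qlpolyD|].
  move=> y ylow; have IHy := IH _ (elimT (lowsP w y) ylow).
  have := actC_lower_mod w s k IHy (lows_I ylow).
  rewrite /G [k == y]eq_sym; case: eqP => [->|_] //.
  by rewrite !mulr0.
have XE : coord (C s (c w)) k =
    coord (C s (b w)) k - \sum_(y <- lows w) q * lpoly (Q y w) * F y.
  rewrite cE actCD // bcoordD actCN // bcoordN actC_sum // bcoord_sum.
  congr (_ - _); apply: eq_bigr => y _.
  by rewrite actCZ // bcoordZ.
have coefE : (wg_coef s w k)%:~R =
    (`[< I (sg s * w)%g >] && (k == sg s * w)%g)%:R +
    (if k \in lows w then G k else 0).
  rewrite /wg_coef /G; case: (lowsP w k) => [lowk|nlowk]; last first.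
    by rewrite ifF ?addr0 ?mulrz_nat //; apply/asboolP => -[].
  case: asboolP => [[_ Dk]|nlow]; last first.
    by rewrite ifF ?addr0 ?mulrz_nat //; apply/asboolP => Dk; apply: nlow.
  rewrite ifT; last exact/asboolP.
  case: (k =P (sg s * w)%g) => [kE|_]; last by rewrite andbF add0r.
  have [ltw _] := ascentP nDw.
  by case: lowk; rewrite kE => _ /(bruhat_lt_asym ltw).
have := qlpolyD (actC_standard_mod k Iw nDw) (qlpolyN low_sum).
by congr qlpoly; rewrite XE coefE opprD !opprD !addrA; ring.
Qed.

Lemma actC_ascent_expansion w s : I w -> wg_formula w -> ~ D w s ->
  I (sg s * w)%g -> C s (c w) =
    c (sg s * w)%g + \sum_(y <- lows w | `[< D y s >]) ((Q y w)`_0)%:~R *: c y.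
Proof.
move=> Iw /(_ s)[_ asc] nDw Isw; apply: (bcoord_inj (c_basis := c_basis)).
apply/funext => k; rewrite asc // bcoordD (bcoord_basis c_basis) // -big_filter.
rewrite (bcoord_sum_basis c_basis) ?filter_uniq ?lows_uniq //; last first.
  by move=> y; rewrite mem_filter => /andP[_ /lows_I].
rewrite mem_filter /wg_coef; case: asboolP => [[/[dup] lowk /lowsP-> Dk]|nlow].
  rewrite ifT ?andbT; last exact/asboolP.
  case: eqP => [kE|_]; last by rewrite add0r.
  have [ltw _] := ascentP nDw.
  by case: lowk; rewrite -kE => _ /(bruhat_lt_asym ltw).
rewrite ifF ?addr0; last first.
  by apply/negP => /andP[/asboolP Dk /lowsP lowk]; apply: nlow.
by rewrite asboolT // eq_sym mulrz_nat.
Qed.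

(** T_s acts as - 1/q on (T_s - q) c_{sw}, whose expansion consists of c_w and
    of multiples of c_y with y < w, on which T_s acts as - 1/q by induction. *)
Lemma wg_formula_SD w s : I w -> (forall y, low w y -> wg_formula y) ->
  SD sg w s -> C s (c w) = - (q + qV) *: c w.
Proof.
move=> Iw IH sdw; set v := (sg s * w)%g.
have Iv : I v := ideal_SD Iw sdw.
have nDv : ~ D v s := SD_ascent Iw sdw.
have ltvw : lt v w by [].
have svE : (sg s * v = w)%g by rewrite /v (sgK coxWS).
have Cv := actC_ascent_expansion Iv (IH _ (conj Iv ltvw)) nDv.
rewrite svE in Cv; have := actCC actM s (c v); rewrite {}Cv //.
rewrite actCD // actC_sum // scalerDr scaler_sumr.
suff -> : \sum_(y <- lows v | `[< D y s >]) C s (((Q y v)`_0)%:~R *: c y) =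
    \sum_(y <- lows v | `[< D y s >]) - (q + qV) *: (((Q y v)`_0)%:~R *: c y).
  exact: addIr.
rewrite big_seq_cond [RHS]big_seq_cond; apply: eq_bigr => y.
case/andP => /lowsP[Iy ltyv] /asboolP Dy; rewrite actCZ //.
have ltyw : lt y w.
  split; first by apply: rt_trans ltyv.1 ltvw.1.
  move=> yw; move: (bruhat_lt_asym ltyv); apply; by rewrite yw.
by rewrite (IH y (conj Iy ltyw) s).1 // !scalerA mulrC.
Qed.

(** The operator F = T_s + 1/q commutes with the bar involution and kills b_w.
    Hence F c_w = - q sum Q_{y,w} F c_y over the y < w of which s is an ascent,
    and the coefficient of such a c_y is - (q^2 + 1) Q_{y,w}. As F c_w is
    bar-invariant, this coefficient must vanish. *)
Lemma wg_formula_WD w s : I w -> (forall y, low w y -> wg_formula y) ->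
  WD sg J w s -> C s (c w) = - (q + qV) *: c w.
Proof.
move=> Iw IH wdw.
have Cb : C s (b w) = - (q + qV) *: b w.
  by apply/actC_negP; exact: (wgi_WD idealIJ Iw wdw).
pose F v := C s v + (q + qV) *: v.
have FE : F (c w) = - \sum_(y <- lows w | ~~ `[< D y s >])
                       (q * lpoly (Q y w)) *: F (c y).
  have cE : c w = b w - \sum_(y <- lows w) (q * lpoly (Q y w)) *: c y.
    by rewrite standard_basisE // addrK.
  rewrite /F cE actCD // Cb actCN // actC_sum // scalerDr addrACA scaleNr addNr.
  rewrite add0r scalerN -opprD scaler_sumr -big_split /=; congr (- _).
  rewrite (bigID (fun y => `[< D y s >])) /= big_seq_cond big1 ?add0r.
    apply: eq_bigr => y _.
    by rewrite actCZ // [in RHS]scalerDr !scalerA [(q + qV) * _]mulrC.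
  move=> y /andP[/lowsP lowy /asboolP Dy]; rewrite actCZ //.
  rewrite (IH y lowy s).1 // !scalerA -scalerDl mulrN.
  by rewrite [(q + qV) * _]mulrC addNr scale0r.
suff Q0 y : low w y -> ~ D y s -> Q y w = 0.
  apply/eqP; rewrite -subr_eq0 scaleNr opprK -/(F _) FE oppr_eq0.
  rewrite big_seq_cond big1 // => y /andP[/lowsP lowy /asboolP nDy].
  by rewrite Q0 // rmorph0 mulr0 scale0r.
move=> lowy nDy.
have coordF : coord (F (c w)) y = - ((q + qV) * (q * lpoly (Q y w))).
  rewrite FE bcoordN bcoord_sum; congr (- _).
  rewrite big_seq_cond.
  rewrite (eq_bigr (fun j => q * lpoly (Q j w) * (q + qV) * (j == y)%:R));
    last first.
    move=> j /andP[/lowsP lowj /asboolP nDj].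
    rewrite bcoordZ bcoordD (IH j lowj s).2 // bcoordZ (bcoord_basis c_basis);
      last by case: lowj.
    rewrite /wg_coef ifF; last by apply/asboolP => -[].
    case: (y =P (sg s * j)%g) => [yE|_]; last by rewrite andbF add0r mulrA.
    case: nDy; rewrite yE; apply: descent_up; exact: (ascentP nDj).1.
  rewrite -big_seq_cond -big_filter.
  rewrite (sum_delta (fun j => q * lpoly (Q j w) * (q + qV))).
    rewrite ifT; first by rewrite mulrC.
    by rewrite mem_filter; apply/andP; split; [exact/asboolP|exact/lowsP].
  by rewrite filter_uniq ?lows_uniq.
apply: lbar_qqV; apply: oppr_inj; rewrite -rmorphN -coordF bcoordD rmorphD /=.
rewrite actC_bar_invariant // bcoordZ rmorphM rmorphD /= lbar_q lbar_qV.
rewrite [qV + q]addrC (bcoord_basis c_basis) //.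
by rewrite rmorph_nat.
Qed.

Lemma wg_formulaP w : I w -> wg_formula w.
Proof.
have [n] := ubnP (len sg w); elim: n w => // n IHn w; rewrite ltnS => len_w Iw.
have IH y : low w y -> wg_formula y.
  by case=> Iy /(bruhat_lt_len) lty; apply: IHn => //; apply: leq_trans len_w.
move=> s; split=> [[]|nD k].
- exact: wg_formula_SD.
- exact: wg_formula_WD.
- exact: wg_formula_ascent.
Qed.

(** Every term of the expansion of (T_s - q) c_k is a multiple of some c_y of
    which s is a descent. *)
Lemma bcoord_actC0 w s v : I w -> ~ D w s -> coord (C s v) w = 0.
Proof.
move=> Iw nDw; have [r [_ rI _ ->]] := bcoordP c_basis v.
rewrite actC_sum // bcoord_sum big_seq big1 // => k /rI Ik.
rewrite actCZ // bcoordZ; suff -> : coord (C s (c k)) w = 0 by rewrite mulr0.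
have [desc asc] := wg_formulaP Ik s; have [Dk|nDk] := pselect (D k s).
  rewrite desc // bcoordZ (bcoord_basis c_basis) //.
  by case: eqP => [kw|]; [case: nDw; rewrite -kw|rewrite mulr0].
rewrite asc // /wg_coef ifF; last by apply/asboolP => -[].
case: (w =P _) => [wE|_]; last by rewrite andbF.
by case: nDw; rewrite wE; apply: descent_up; exact: (ascentP nDk).1.
Qed.

(** Compare the coefficients of c_w in T_s b_y. If s is a weak descent of y, the
    coefficient q Q_{w,y} of b_y is multiplied both by - 1/q and by q, so it
    vanishes. Otherwise b_y = T_s b_{sy}, and q Q_{w,y} is q times the
    coefficient of c_w in b_{sy}. *)
Lemma coef0_ascent_descent w y s : I w -> I y -> ~ D w s -> D y s -> lt w y ->
  (Q w y)`_0 = (w == sg s * y)%g%:R.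
Proof.
move=> Iw Iy nDw Dy ltwy.
have coord_by : coord (b y) w = q * lpoly (Q w y).
  rewrite bcoord_standard // ifT; last exact/lowsP.
  case: eqP => [yw|_]; last by rewrite add0r.
  by move: ltwy; rewrite yw => -[].
have coordT v : coord (act (hT sg s) v) w = q * coord v w.
  by rewrite act_T bcoordD bcoordZ bcoord_actC0 // addr0.
case: Dy => [sdy|wdy]; last first.
  have ltysy : lt y (sg s * y)%g by case: wdy.
  case: eqP => [wE|_].
    by move: ltwy; rewrite wE => /(bruhat_lt_asym ltysy).
  rewrite (_ : Q w y = 0) ?coef0 //; apply: lbar_qqV.
  have := coordT (b y); rewrite (wgi_WD idealIJ) // bcoordZ coord_by => E.
  have -> : (q + qV) * (q * lpoly (Q w y)) = 0.
    by rewrite mulrDl -E mulNr addNr.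
  by rewrite rmorph0.
set v := (sg s * y)%g; have Iv : I v := ideal_SD Iy sdy.
have byE : b y = act (hT sg s) (b v).
  rewrite (wgi_SA idealIJ) ?(sgK coxWS) //.
  by rewrite /SA /= /v (sgK coxWS); split.
have [p pE] := bcoord_standard_mod w Iv.
move: coord_by; rewrite byE coordT pE => /(congr1 (fun x => qV * x)).
rewrite !mulrA [qV * q]mulrC mulqV !mul1r => E.
have : Q w y = ((v == w)%:R)%:P + 'X * p.
  by apply: lpoly_inj; rewrite -E rmorphD rmorphM /= lpolyC lpolyX mulrz_nat.
by move=> ->; rewrite coefD coefC coefXM addr0 eq_sym.
Qed.

Definition wg_mu y w : int :=
  if `[< lt y w >] then (Q y w)`_0 else if `[< lt w y >] then (Q w y)`_0 else 0.

Lemma wg_mu_coef w k s : I w -> I k -> ~ D w s -> D k s ->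
  wg_mu k w = wg_coef s w k.
Proof.
move=> Iw Ik nDw Dk; have [ltw _] := ascentP nDw.
rewrite /wg_mu /wg_coef; case: asboolP => [ltkw|nltkw].
  by rewrite asboolT.
rewrite [in RHS]asboolF; last by case=> -[].
have kE : (k == sg s * w)%g = (w == sg s * k)%g.
  by apply/eqP/eqP => ->; rewrite (sgK coxWS).
case: asboolP => [ltwk|nltwk].
  rewrite (coef0_ascent_descent Iw Ik nDw Dk ltwk) kE.
  case: eqP => [wE|_]; last by rewrite andbF.
  by rewrite asboolT // wE (sgK coxWS).
by case: eqP => [kE'|_]; [case: nltwk; rewrite kE'|rewrite andbF].
Qed.

(** Among the y > w having s as a descent, only y = sw has a nonzero
    coefficient, so the sum is that of the expansion by [wg_coef]. *)
Proposition wgraph_action w s : I w ->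
  (D w s -> act (hT sg s) (c w) = - qV *: c w) /\
  (~ D w s ->
    finite_set [set y | (I y /\ D y s) /\ wg_mu y w <> 0] /\
    act (hT sg s) (c w) =
      q *: c w + \sum_(y \in [set y | I y /\ D y s]) (wg_mu y w)%:~R *: c y).
Proof.
move=> Iw; have [desc asc] := wg_formulaP Iw s.
split=> [Dw|nDw]; first by apply/actC_negP; apply: desc.
have fin : finite_set [set y | (I y /\ D y s) /\ wg_mu y w <> 0].
  apply: (@sub_finite_set _ _ (low w `|` [set (sg s * w)%g])); last first.
    by rewrite finite_setU; split; [exact: low_finite|exact: finite_set1].
  move=> y [[Iy Dy]]; rewrite (wg_mu_coef Iw Iy nDw Dy) /wg_coef.
  case: asboolP => [[lowy _] _|_]; first by left.
  by case: eqP => [->|_]; [right|rewrite andbF].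
split=> //; rewrite act_T; congr (_ + _).
apply: (bcoord_inj (c_basis := c_basis)); apply/funext => k; rewrite asc //.
rewrite (@bcoord_fsum _ _ _ _ c_basis _ (fun y => (wg_mu y w)%:~R)).
- case: asboolP => [[Ik Dk]|nk]; first by rewrite (wg_mu_coef Iw Ik nDw Dk).
  rewrite /wg_coef asboolF; last by case=> -[Ik _] Dk; apply: nk.
  case: asboolP => //= Isw; case: eqP => // kE; case: nk; rewrite kE; split=> //.
  by apply: descent_up; exact: (ascentP nDw).1.
- by move=> y [].
- apply: sub_finite_set fin => y [[Iy Dy] mu_y]; split=> // mu0.
  by apply: mu_y; rewrite mu0.
Qed.

End WGraphOfIdeal.

(** * The two bar involutions of a biideal *)

Section Biideal.
Variables (W : groupType) (S : Type) (sg : S -> W).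
Hypothesis coxWS : coxeter_system sg.

Section Ideal.
Variables (I : set W) (J : set S) (M : lmodType laurent).
Variables (act : hecke sg -> M -> M) (b : W -> M) (bar : M -> M).
Hypothesis idealIJ : is_wgraph_ideal_module I J act b bar.

Lemma ideal1 : I 1%g.
Proof.
have [[w Iw] down] := wgi_ideal idealIJ.
by apply: down Iw; rewrite /lweak_le invg1 mulg1 len1 addn0.
Qed.

Lemma standard_basis_up s v : len sg (sg s * v)%g = (len sg v).+1 ->
  I (sg s * v)%g -> I v /\ act (hT sg s) (b v) = b (sg s * v)%g.
Proof.
move=> lenE Isv; have ltv : bruhat_lt sg v (sg s * v)%g.
  by apply/bruhat_lt_sgP => //; rewrite lenE.
have Iv : I v.
  rewrite -(sgK coxWS s v); apply: (ideal_SD coxWS idealIJ) => //.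
  by rewrite /SD /= (sgK coxWS).
by split=> //; apply: (wgi_SA idealIJ) => //; split.
Qed.

(** The standard basis is obtained from b_1 by products of generators, along
    reduced words; P records what is needed of these products. *)
Lemma standard_basis_cyclic (P : hecke sg -> Prop) : P 1 ->
  (forall s h, P h -> P (hT sg s * h)) ->
  forall w, I w -> exists2 h, P h & b w = act h (b 1%g).
Proof.
move=> P1 PT w; have [n] := ubnP (len sg w).
elim: n w => // n IHn w; rewrite ltnS => len_w Iw.
have [->|/eqP w1] := eqVneq w 1%g.
  by exists 1; rewrite // (act1 (wgi_hmodule idealIJ)).
have [s [v [wE lenE]]] := len_left_descent coxWS w1.
rewrite wE in lenE Iw *; have [Iv <-] := standard_basis_up lenE Iw.
have [|h Ph ->] := IHn v _ Iv; first by rewrite -ltnS -lenE -wE.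
by exists (hT sg s * h); [exact: PT|rewrite (act_hM (wgi_hmodule idealIJ))].
Qed.

Lemma bar_eq (bar' : M -> M) :
  {morph bar' : u v / u + v} -> (forall a v, bar' (a *: v) = lbar a *: bar' v) ->
  (forall w, I w -> bar' (b w) = bar (b w)) -> bar' =1 bar.
Proof.
move=> barD' barZ' barb v; have [barD barZ _ _] := wgi_bar idealIJ.
have [_ /(_ v)[r [a [rI ->]]]] := wgi_basis idealIJ.
elim: r rI => [|w r IHr] rI.
  rewrite !big_nil; have := barZ 0 0; have := barZ' 0 0.
  by rewrite !rmorph0 !scale0r => -> ->.
rewrite !big_cons barD' barD barZ' barZ barb; last by apply: rI; rewrite inE eqxx.
by rewrite IHr // => k kr; apply: rI; rewrite inE kr orbT.
Qed.

End Ideal.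

Variables (I : set W) (J K : set S) (M : lmodType laurent).
Variables (act acto : hecke sg -> M -> M) (b : W -> M) (bar baro : M -> M).
Hypothesis biidealIJK : is_wgraph_biideal_module I J K act acto b bar baro.

Let idealIJ : is_wgraph_ideal_module I J act b bar.
Proof. by case: biidealIJK. Qed.
Let idealIK : is_wgraph_ideal_module (invset I) K acto (invfam b) baro.
Proof. by case: biidealIJK. Qed.
Let actM := wgi_hmodule idealIJ.
Let actoM := wgi_hmodule idealIK.

Lemma act_actoT h s v :
  act h (acto (hT sg s) v) = acto (hT sg s) (act h v).
Proof.
by have [_ _ comm] := biidealIJK; have := comm h (hT sg s) v; rewrite hflatT.
Qed.

Let commutes h' := forall h v, act h (acto h' v) = acto h' (act h v).

Lemma commutes_hTV s : commutes (hTV sg s).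
Proof.
move=> h v; rewrite !(act_TV actoM) (actD actM) (actN actM) (actZ actM).
by rewrite act_actoT.
Qed.

(** This is where the identification of the left and right standard bases
    enters: b_1 T_s and T_s b_1 are both b_s. *)
Lemma generator_b1 s : I (sg s) -> act (hT sg s) (b 1%g) = acto (hT sg s) (b 1%g).
Proof.
have lenE : len sg (sg s * 1)%g = (len sg 1%g).+1.
  by rewrite mulg1 (len_sg coxWS) (len1 sg).
move=> Is; have [|_ ->] := standard_basis_up idealIJ lenE; first by rewrite mulg1.
have [|_] := standard_basis_up idealIK lenE.
  by rewrite mulg1 /invset /= (sgV coxWS).
by rewrite /invfam invg1 !mulg1 (sgV coxWS).
Qed.

(** Both involutions fix b_1. An element b_w with w = s v and v shorter than w
    is T_s b_v, and b_v is b_1 multiplied on the right by some h. As s is a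
    prefix of w, it lies in the ideal, so that T_s b_1 = b_1 T_s. Hence both
    involutions send b_w to b_1 multiplied on the right by the bar of T_s h. *)
Lemma biideal_bar : baro =1 bar.
Proof.
have [barD barZ _ barA] := wgi_bar idealIJ.
have [baroD baroZ _ baroA] := wgi_bar idealIK.
apply: (bar_eq idealIJ) => // w.
have [n] := ubnP (len sg w); elim: n w => // n IHn w; rewrite ltnS => len_w Iw.
have [->|/eqP w1] := eqVneq w 1%g.
  by rewrite (wgi_bar1 idealIJ); have := wgi_bar1 idealIK; rewrite /invfam invg1.
have [s [v [wE lenE]]] := len_left_descent coxWS w1.
rewrite wE in lenE Iw *; have [Iv <-] := standard_basis_up idealIJ lenE Iw.
have Is : I (sg s).
  have [_ down] := wgi_ideal idealIK.
  rewrite -(sgV coxWS); apply: (down _ ((sg s * v)^-1)%g).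
    rewrite /lweak_le !(lenV coxWS) (len_sg coxWS) -invgM (lenV coxWS).
    by rewrite mulgA (sg_mul_self coxWS) mul1g lenE addn1.
  by rewrite /invset /= invgK.
have [h [comm_h comm_hbar]] : exists2 h, commutes h /\ commutes (hbar h) &
    invfam b (v^-1)%g = acto h (invfam b 1%g).
  apply: (standard_basis_cyclic idealIK).
  - by split=> h u; rewrite ?rmorph1 !(act1 actoM).
  - move=> t h [ch chb]; split=> h' u; rewrite ?rmorphM /= ?hbarT !(act_hM actoM).
      by rewrite act_actoT ch.
    by rewrite commutes_hTV chb.
  - by rewrite /invset /= invgK.
rewrite /invfam invgK invg1 => bvE.
rewrite barA hbarT -IHn //; last by rewrite -ltnS -lenE -wE.
have baro1 : baro (b 1%g) = b 1%g.
  by have := wgi_bar1 idealIK; rewrite /invfam invg1.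
rewrite bvE comm_h generator_b1 // !baroA baro1 comm_hbar hbarT.
by rewrite (act_TV actM) (act_TV actoM) generator_b1.
Qed.

Variables (c : W -> M) (Q : W -> W -> {poly int}).
Hypothesis cP : is_wgraph_basis sg I b bar c Q.

(** Once the involutions agree, this is the reindexing of the left W-graph basis
    by inversion, which preserves the Bruhat order. *)
Lemma right_wgraph_basis :
  is_wgraph_basis sg (invset I) (invfam b) baro (invfam c)
    (fun y w => Q (y^-1)%g (w^-1)%g).
Proof.
have [[free span] barc bE] := cP; split.
- split=> [r a r_uniq rI s0 k kr|v].
    rewrite -[k]invgK.
    apply: (free [seq (x^-1)%g | x <- r] (fun j => a (j^-1)%g)).
    + by rewrite map_inj_uniq //; exact: invg_inj.
    + by move=> _ /mapP[j /rI Ij ->].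
    + by rewrite big_map -[RHS]s0; apply: eq_bigr => j _; rewrite invgK.
    + exact: (map_f (fun x => (x^-1)%g)).
  have [r [a [rI ->]]] := span v.
  exists [seq (x^-1)%g | x <- r], (fun j => a (j^-1)%g).
  split=> [_ /mapP[j /rI Ij ->]|]; first by rewrite /invset /= invgK.
  by rewrite big_map; apply: eq_bigr => j _; rewrite /invfam invgK.
- by move=> w Iw; rewrite biideal_bar; exact: barc.
- move=> w Iw; rewrite /invfam bE //; congr (_ + _ *: _).
  apply: (reindex_fsbig (fun x : W => (x^-1)%g)); split.
  + move=> y [Iy lty]; split=> //; exact/(bruhat_ltV coxWS).
  + by move=> y z _ _; exact: invg_inj.
  + move=> y [Iy lty]; exists (y^-1)%g; rewrite ?invgK //; split.
      by rewrite /invset /= invgK.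
    by apply/(bruhat_ltV coxWS); rewrite invgK.
Qed.

End Biideal.

(** * The module over the Hecke algebra of W x W^o *)

Section LinearEndomorphisms.
Variable M : lmodType laurent.

(** The ring in which the universal property of the presentation of the Hecke
    algebra takes its values. *)
Record lend := Lend { lapp :> M -> M; _ : linear lapp }.

HB.instance Definition _ := gen_eqMixin lend.
HB.instance Definition _ := gen_choiceMixin lend.

Lemma lapp_linear (x : lend) : linear x.
Proof. by case: x. Qed.

Lemma lendP (x y : lend) : x =1 y -> x = y.
Proof.
case: x y => [f flin] [g glin] /= /funext fg; case: g / fg glin => glin.
by congr Lend; exact: Prop_irrelevance.
Qed.

Lemma lapp_lin1 (x : lend) u v : x (u + v) = x u + x v.
Proof. by have := lapp_linear x 1 u v; rewrite !scale1r. Qed.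

Let add_lin (x y : lend) : linear (fun v => x v + y v).
Proof. by move=> a u v; rewrite !lapp_linear scalerDr addrACA. Qed.
Let opp_lin (x : lend) : linear (fun v => - x v).
Proof. by move=> a u v; rewrite lapp_linear opprD scalerN. Qed.
Let zero_lin : linear (fun _ : M => 0 : M).
Proof. by move=> a u v; rewrite scaler0 addr0. Qed.
Let one_lin : linear (fun v : M => v).
Proof. by []. Qed.
Let mul_lin (x y : lend) : linear (fun v => x (y v)).
Proof. by move=> a u v; rewrite !lapp_linear. Qed.

Let add x y := Lend (add_lin x y).
Let opp x := Lend (opp_lin x).
Let zero := Lend zero_lin.
Let one := Lend one_lin.
Let mul x y := Lend (mul_lin x y).

Let addA : associative add.
Proof. by move=> x y z; apply: lendP => v /=; rewrite addrA. Qed.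
Let addC : commutative add.
Proof. by move=> x y; apply: lendP => v /=; rewrite addrC. Qed.
Let add0 : left_id zero add.
Proof. by move=> x; apply: lendP => v /=; rewrite add0r. Qed.
Let addN : left_inverse zero opp add.
Proof. by move=> x; apply: lendP => v /=; rewrite addNr. Qed.
Let mulA : associative mul.
Proof. by move=> x y z; apply: lendP. Qed.
Let mul1 : left_id one mul.
Proof. by move=> x; apply: lendP. Qed.
Let mule1 : right_id one mul.
Proof. by move=> x; apply: lendP. Qed.
Let mulDl : left_distributive mul add.
Proof. by move=> x y z; apply: lendP. Qed.
Let mulDr : right_distributive mul add.
Proof. by move=> x y z; apply: lendP => v /=; rewrite lapp_lin1. Qed.

HB.instance Definition _ := GRing.isZmodule.Build lend addA addC add0 addN.
HB.instance Definition _ := GRing.Zmodule_isPzRing.Build lend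
  mulA mul1 mule1 mulDl mulDr.

Lemma lappM (x y : lend) v : (x * y) v = x (y v). Proof. by []. Qed.

Lemma homothety_linear (a : laurent) : linear (fun v : M => a *: v).
Proof. by move=> e u v; rewrite scalerDr !scalerA mulrC. Qed.

Definition homothety (a : laurent) : lend := Lend (homothety_linear a).

Lemma homothety_is_zmod_morphism : zmod_morphism homothety.
Proof. by move=> a e; apply: lendP => v /=; rewrite scalerBl. Qed.
Lemma homothety_is_monoid_morphism : monoid_morphism homothety.
Proof.
by split=> [|a e]; apply: lendP => v /=; rewrite ?scale1r ?scalerA.
Qed.
HB.instance Definition _ := GRing.isZmodMorphism.Build laurent lend homothety
  homothety_is_zmod_morphism.
HB.instance Definition _ := GRing.isMonoidMorphism.Build laurent lend homothety
  homothety_is_monoid_morphism.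

Lemma homothetyC a (x : lend) : homothety a * x = x * homothety a.
Proof.
apply: lendP => v; rewrite !lappM /= -[v in RHS]addr0.
have x0 : x 0 = 0.
  by have := lapp_lin1 x 0 0; rewrite addr0 -{1}[x 0]addr0 => /addrI.
by rewrite -[a *: (v + 0)]addr0 lapp_linear x0 !addr0.
Qed.

End LinearEndomorphisms.

Section HeckeModuleOfGenerators.
Variables (W : groupType) (S : Type) (sg : S -> W) (M : lmodType laurent).
Variable g : S -> lend M.
Hypothesis g_quad : forall s v, g s (g s v) = v + (q - qV) *: g s v.
Hypothesis g_braid : forall s t m, is_order (sg s * sg t)%g m ->
  altprod (g s) (g t) m = altprod (g t) (g s) m.

Definition gen_act : hecke sg -> M -> M := hecke_lift (@homothety M) g.

Let g_quad' s : g s * g s = 1 + homothety M (q - qV) * g s.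
Proof. by apply: lendP => v; rewrite lappM g_quad. Qed.

Lemma gen_actT s v : gen_act (hT sg s) v = g s v.
Proof. by rewrite /gen_act (hecke_lift_pi (@homothetyC M) g_quad' g_braid). Qed.

Lemma gen_act_hmodule : is_hmodule gen_act.
Proof.
pose lift : hecke sg -> lend M := hecke_lift (@homothety M) g.
have liftB h h' : lift (h - h') = lift h - lift h'.
  exact: (hecke_lift_zmod_morphism (@homothetyC M) g_quad' g_braid).
have [lift1 liftM] : monoid_morphism lift.
  exact: (hecke_lift_monoid_morphism (@homothetyC M) g_quad' g_braid).
have liftA a : lift a%:A = homothety M a.
  by rewrite -hpi_scal; exact: (hecke_lift_pi (@homothetyC M) g_quad' g_braid).
have liftZ a h : lift (a *: h) = homothety M a * lift h.
  by rewrite -mulr_algl liftM liftA.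
have lift0 : lift 0 = 0 by rewrite -(subrr 0) liftB subrr.
have liftD h h' : lift (h + h') = lift h + lift h'.
  by rewrite -[h']opprK liftB -[in LHS]sub0r liftB lift0 sub0r !opprK.
split.
- by move=> h; exact: lapp_linear.
- by move=> v a h h'; rewrite /gen_act -/lift liftD liftZ.
- by move=> v; rewrite /gen_act -/lift lift1.
- by move=> h h' v; rewrite /gen_act -/lift liftM.
Qed.

End HeckeModuleOfGenerators.

Section TwoSidedModule.
Variables (W : groupType) (S : Type) (sg : S -> W).
Hypothesis coxWS : coxeter_system sg.
Variables (M : lmodType laurent) (act acto : hecke sg -> M -> M).
Hypotheses (actM : is_hmodule act) (actoM : is_hmodule acto).
Hypothesis act_actoC : forall s t v,
  act (hT sg s) (acto (hT sg t) v) = acto (hT sg t) (act (hT sg s) v).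

Definition lend_act (act0 : hecke sg -> M -> M) (act0M : is_hmodule act0) h :=
  Lend (let: And4 lin _ _ _ := act0M in lin h).

Definition bimod_gen (u : S + S) : lend M :=
  match u with
  | inl s => lend_act actM (hT sg s)
  | inr s => lend_act actoM (hT sg s)
  end.

Lemma lend_act_alt act0 (act0M : is_hmodule act0) h h' m :
  altprod (lend_act act0M h) (lend_act act0M h') m =
  lend_act act0M (altprod h h' m).
Proof.
elim: m h h' => [|m IHm] h h'; apply: lendP => v.
  by rewrite /= act1.
rewrite [altprod (lend_act _ _) _ _]/= lappM IHm [altprod h h' m.+1]/=.
by rewrite /= act_hM.
Qed.

Lemma prodgX (G H : groupType) (x : prodg G H) k :
  (x ^+ k)%g = ((x.1 ^+ k)%g, (x.2 ^+ k)%g).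
Proof. by elim: k => [|k IHk]; rewrite ?expg0 // !expgS IHk. Qed.

Lemma oppgX (G : groupType) (x : oppg G) k : (x ^+ k)%g = ((x : G) ^+ k)%g :> G.
Proof. by elim: k => [|k IHk]; rewrite ?expg0 // expgS expgSr -IHk. Qed.

Lemma bimod_gen_quad u v :
  bimod_gen u (bimod_gen u v) = v + (q - qV) *: bimod_gen u v.
Proof. by case: u => s /=; rewrite act_TT. Qed.

(** Pairs of generators on the same side inherit the order of their product in
    W, and hence the braid relation, which is reversed in the opposite group.
    For a mixed pair the product has order 2 and the relation is commutation. *)
Lemma bimod_gen_braid u u' m : is_order (sg2 sg u * sg2 sg u')%g m ->
  altprod (bimod_gen u) (bimod_gen u') m = altprod (bimod_gen u') (bimod_gen u) m.
Proof.
have mixed s t : altprod (bimod_gen (inl s)) (bimod_gen (inr t)) 2 =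
    altprod (bimod_gen (inr t)) (bimod_gen (inl s)) 2.
  by apply: lendP => v; exact: act_actoC.
have mixed2 s t n : is_order ((sg s, sg t) : prodg W (oppg W)) n -> n = 2.
  case=> n0 xn minx; apply/eqP; rewrite eqn_leq; apply/andP; split.
    rewrite leqNgt; apply/negP => n2; apply: (minx 2 n2).
    rewrite prodgX; apply: injective_projections; rewrite /= ?oppgX expg2 //;
      exact: (sg_mul_self coxWS).
  case: n n0 xn {minx} => [//|[_|//]]; rewrite expg1 => -[s1 _].
  by case: (sg_neq1 coxWS s1).
case: u u' => [s|s] [t|t] /= mP.
- rewrite !lend_act_alt hT_braid //; case: mP => m0 xm minx; split=> // [|k km xk].
    by have := congr1 fst xm; rewrite prodgX.
  apply: (minx k km); rewrite prodgX; apply: injective_projections => //=.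
  by rewrite mulg1 expg1n.
- have {mP} : is_order ((sg s, sg t) : prodg W (oppg W)) m.
    by move: mP; rewrite /monoid.mul /= mulg1 mul1g.
  by move=> /mixed2->; exact: mixed.
- have {mP} : is_order ((sg t, sg s) : prodg W (oppg W)) m.
    by move: mP; rewrite /monoid.mul /= mulg1 mul1g.
  by move=> /mixed2->; exact/esym/mixed.
- rewrite !lend_act_alt -hT_braid //; case: mP => m0 xm minx; split=> // [|k km xk].
    by have := congr1 snd xm; rewrite prodgX /= oppgX.
  apply: (minx k km); rewrite prodgX; apply: injective_projections => /=.
    by rewrite mul1g expg1n.
  by rewrite oppgX.
Qed.

End TwoSidedModule.

(** * The W x W^o-graph *)

(** The rule for the action of the generators survives a change of indices of
    the basis. *)
Lemma wgraph_action_reindex (W : groupType) (S : Type) (sg : S -> W)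
    (M : lmodType laurent) (act : hecke sg -> M -> M) (V : choiceType)
    (e : V -> M) (mu : V -> V -> int) (tau : V -> Prop)
    (I : set W) (c : W -> M) (m : W -> W -> int) (D : W -> Prop)
    (f : V -> W) (s : S) (v : V) :
  injective f -> (forall u, I (f u)) -> (forall y, I y -> exists u, f u = y) ->
  (forall u, e u = c (f u)) -> (forall u, mu u v = m (f u) (f v)) ->
  (forall u, tau u <-> D (f u)) ->
  (D (f v) -> act (hT sg s) (c (f v)) = - qV *: c (f v)) /\
  (~ D (f v) ->
    finite_set [set y | (I y /\ D y) /\ m y (f v) <> 0] /\
    act (hT sg s) (c (f v)) =
      q *: c (f v) + \sum_(y \in [set y | I y /\ D y]) (m y (f v))%:~R *: c y) ->
  (tau v -> act (hT sg s) (e v) = - qV *: e v) /\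
  (~ tau v -> finite_set [set u | tau u /\ mu u v <> 0] /\
    act (hT sg s) (e v) =
      q *: e v + \sum_(u \in [set u | tau u]) (mu u v)%:~R *: e u).
Proof.
move=> f_inj fI f_surj eE muE tauE [desc asc]; rewrite eE.
split=> [/tauE/desc//|nv].
have {asc}[|fin ->] := asc; first by move=> /tauE.
split.
  apply: sub_finite_set (finite_preimage (f := f) _ fin); last first.
    by move=> ? ? _ _; exact: f_inj.
  by move=> u [/tauE Du mu_u]; split; rewrite -?muE.
congr (_ + _); rewrite (reindex_fsbig f [set u | tau u]).
  by apply: eq_fsbigr => u _; rewrite muE eE.
by split=> [u /tauE|u u' _ _|y [/f_surj[u <-] /tauE]];
  [split|exact: f_inj|exists u].
Qed.

(** A W-graph has its basis as set of vertices: the index of a vertex is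
    recovered by the injectivity of c on I. *)
Lemma image_basis (W : choiceType) (M : lmodType laurent) (I : set W) (c : W -> M) :
  is_basis I c -> I !=set0 -> exists f : c @` I -> W,
    [/\ injective f, forall u, I (f u), forall y, I y -> exists u, f u = y,
      forall u, val u = c (f u) & is_basis setT (fun u : c @` I => val u)].
Proof.
move=> c_basis [w0 Iw0].
have c_inj y w : I y -> I w -> c y = c w -> y = w.
  move=> Iy Iw cE; have := bcoord_basis c_basis y Iy.
  rewrite cE (bcoord_basis c_basis) // eqxx; case: eqP => // _ /eqP.
  by rewrite eq_sym oner_eq0.
have preim (u : c @` I) : exists2 w, I w & c w = val u := set_valP u.
pose f u := s2val (cid2 (preim u)).
have fI u : I (f u) by rewrite /f; case: cid2.
have fE u : val u = c (f u) by rewrite /f; case: cid2.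
have f_inj : injective f by move=> u v uv; apply: val_inj; rewrite !fE uv.
pose u0 : c @` I := SigSub (mem_set (imageP c Iw0)).
pose g w : c @` I := insubd u0 (c w).
have gE w : I w -> val (g w) = c w.
  by move=> Iw; rewrite val_insubd ifT //; apply/mem_set/imageP.
have fg w : I w -> f (g w) = w by move=> Iw; apply: c_inj; rewrite -?fE ?gE.
exists f; split=> //; first by move=> y Iy; exists (g y); exact: fg.
split=> [r a r_uniq _ s0 u ur|v].
  have := bcoord_sum c_basis r xpredT (fun u : c @` I => a u *: val u) (f u).
  rewrite s0 bcoord0 => /esym; rewrite (eq_bigr (fun j => a j * (j == u)%:R)).
    by rewrite sum_delta // ur.
  by move=> j _; rewrite bcoordZ fE (bcoord_basis c_basis) // (inj_eq f_inj).
have [_ /(_ v)[r [a [rI ->]]]] := c_basis.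
exists (map g r), (a \o f); split=> //; rewrite big_map.
by apply: eq_big_seq => w /rI Iw /=; rewrite gE // fg.
Qed.

Theorem theorem6p6 (W : groupType) (S : Type) (sg : S -> W)
    (coxWS : coxeter_system sg)
    (I : set W) (J K : set S) (M : lmodType laurent)
    (act acto : hecke sg -> M -> M) (b : W -> M) (bar baro : M -> M)
    (biidealIJK : is_wgraph_biideal_module I J K act acto b bar baro)
    (c : W -> M) (Q : W -> W -> {poly int})
    (c_basis : is_wgraph_basis sg I b bar c Q)
    (mu : c @` I -> c @` I -> int) (tau : c @` I -> set (S + S)%type)
    (muE : forall (x z : c @` I) (y w : W), I y -> I w ->
       val x = c y -> val z = c w ->
       mu x z = if `[< bruhat_lt sg y w >] then (Q y w)`_0
                else if `[< bruhat_lt sg w y >] then (Q w y)`_0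
                else 0)
    (tauE : forall (x : c @` I) (w : W), I w -> val x = c w ->
       tau x = (inl @` descents sg J w) `|` (inr @` descents sg K (w^-1)%g)) :
  is_wgraph_basis sg (invset I) (invfam b) baro (invfam c)
    (fun y w => Q (y^-1)%g (w^-1)%g) /\
  is_wgraph (sg2 sg) mu tau.
Proof.
have right_basis := right_wgraph_basis coxWS biidealIJK c_basis; split=> //.
have [idealIJ idealIK _] := biidealIJK.
have actM := wgi_hmodule idealIJ; have actoM := wgi_hmodule idealIK.
have act_actoC s t v := act_actoT biidealIJK (hT sg s) t v.
have cI : is_basis I c by case: c_basis.
have [f [f_inj fI f_surj fE eM]] := image_basis cI (ex_intro _ _ (ideal1 idealIJ)).
pose gen := bimod_gen actM actoM.
have gen_quad := bimod_gen_quad actM actoM.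
have gen_braid := bimod_gen_braid coxWS actM actoM act_actoC.
have tau_l u s : tau u (inl s) <-> descents sg J (f u) s.
  rewrite (tauE _ _ (fI u) (fE u)); split=> [[[t ? [<-]]|[]]|Ds] //.
  by left; exists s.
have tau_r u s : tau u (inr s) <-> descents sg K (f u)^-1%g s.
  rewrite (tauE _ _ (fI u) (fE u)); split=> [[[]|[t ? [<-]]]|Ds] //.
  by right; exists s.
have mu_l u v : mu u v = wg_mu sg Q (f u) (f v) by apply: muE.
have mu_r u v : mu u v = wg_mu sg (fun y w => Q (y^-1)%g (w^-1)%g)
    (f u)^-1%g (f v)^-1%g.
  rewrite mu_l /wg_mu !invgK.
  by rewrite !(propext (bruhat_ltV coxWS _ _)).
have wg u v : (tau v u ->
      gen_act gen (hT (sg2 sg) u) (val v) = - qV *: val v) /\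
    (~ tau v u -> finite_set [set x | tau x u /\ mu x v <> 0] /\
      gen_act gen (hT (sg2 sg) u) (val v) =
        q *: val v + \sum_(x \in [set x | tau x u]) (mu x v)%:~R *: val x).
  rewrite (gen_actT gen_quad gen_braid); case: u => s /=.
    apply: (wgraph_action_reindex f_inj fI f_surj fE (mu_l^~ v) (tau_l^~ s)).
    exact: (wgraph_action coxWS idealIJ c_basis).
  apply: (wgraph_action_reindex (f := fun u => (f u)^-1%g) (I := invset I)
    (c := invfam c) (D := fun y => descents sg K y s)
    _ _ _ _ (mu_r^~ v) (tau_r^~ s)).
  - by move=> x y /invg_inj/f_inj.
  - by move=> x; rewrite /invset /= invgK.
  - by move=> y /f_surj[x xE]; exists x; rewrite xE invgK.
  - by move=> x; rewrite /invfam invgK; exact: fE.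
  - by apply: (wgraph_action coxWS idealIK right_basis); rewrite /invset /= invgK.
exists M, (fun u : c @` I => val u), (gen_act gen); split=> //.
- exact: (gen_act_hmodule gen_quad gen_braid).
- by move=> u v; case: (wg u v).
- by move=> u v; case: (wg u v).
Qed.
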